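(* The category $\mathsf{SDL}$ of left-handed strongly distributive skew lattices with zero and proper homomorphisms is dually equivalent to the category $\mathsf{Sh}(\mathsf{LPS})$ of sheaves over local Priestley spaces; that is, there is an equivalence of categories $\mathsf{SDL}^{\mathrm{op}}\simeq \mathsf{Sh}(\mathsf{LPS})$.
   Context: **Skew lattices.** A skew lattice (with zero) is an algebra $(S,\wedge,\vee,0)$ such that $\wedge,\vee$ are associative and idempotent, the absorption identities $x\wedge(x\vee y)=x=x\vee(x\wedge y)$ and $(y\vee x)\wedge x=x=(y\wedge x)\vee x$ hold, and $x\wedge 0=0=0\wedge x$. It is strongly distributive if $x\wedge(y\vee z)=(x\wedge y)\vee(x\wedge z)$ and $(y\vee z)\wedge x=(y\wedge x)\vee(z\wedge x)$ hold, and left-handed if $x\wedge y\wedge x=x\wedge y$ holds (equivalently $x\vee y\vee x=y\vee x$). Homomorphisms preserve $\wedge,\vee,0$. The relation $\mathcal D$ on $S$ is given by $x\mathrel{\mathcal D}y$ iff $x\wedge y\wedge x=x$ and $y\wedge x\wedge y=y$; it is a congruence and $S/\mathcal D$ is the largest lattice quotient of $S$. A homomorphism $h:S\to T$ induces a lattice homomorphism $\overline h:S/\mathcal D\to T/\mathcal D$. A lattice homomorphism $k:L_1\to L_2$ is proper if for every $y\in L_2$ there is $x\in L_1$ with $k(x)\ge y$; a skew lattice homomorphism $h$ is proper if $\overline h$ is proper. $\mathsf{SDL}$ has as objects the left-handed strongly distributive skew lattices with zero and as morphisms the proper homomorphisms. **Local Priestley spaces.** A Priestley space is a compact topological space with a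 partial order such that whenever $x\not\le y$ there are disjoint clopen sets $U,V$ with $U$ an upset, $V$ a downset, $x\in U$, $y\in V$. For a partially ordered topological space $(X,\tau,\le)$, its ordered one-point-compactification is $\widehat X=X\cup\{\ast\}$, $\ast\notin X$, where a set $U$ is open iff $U\in\tau$, or $\ast\in U$ and $X\setminus U$ is closed and compact in $X$; the order extends $\le$ by making $\ast$ the maximum. $(X,\tau,\le)$ is a local Priestley space if its ordered one-point-compactification is a Priestley space. $\mathsf{LPS}$ is the category of local Priestley spaces, a morphism $f:X\to Y$ being the restriction of a continuous monotone map $f:\widehat X\to\widehat Y$ with $f^{-1}(\ast_Y)=\{\ast_X\}$. **Sheaves.** All sheaves (of sets) are assumed to have global support: every stalk is non-empty, equivalently the associated étale map (local homeomorphism) $p:E\to X$ is surjective. An object of $\mathsf{Sh}(\mathsf{LPS})$ is a local Priestley space $X$ together with such a sheaf $E$ on the topological space $X$. A morphism $(X,E)\to(Y,F)$ is a pair $(f,\lambda)$ where $f:X\to Y$ is a morphism of $\mathsf{LPS}$ and $\lambda:F\Rightarrow f_\ast E$ is a natural transformation, with $(f_\ast E)(V)=E(f^{-1}(V))$ for $V$ open in $Y$. The composite of $(f,\lambda):(X,E)\to(Y,F)$ and $(g,\mu):(Y,F)\to(Z,G)$ is $(gf,\sigma)$ with $\sigma_U=\lambda_{g^{-1}(U)}\circ\mu_U$. *)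

(* Defs.v *)
From HB Require Import structures.
From mathcomp Require Import all_boot all_order.
From mathcomp Require Import all_classical topology.

Set Implicit Arguments.
Unset Strict Implicit.
Unset Printing Implicit Defensive.

Import Order.TTheory.
Local Open Scope classical_set_scope.
Local Open Scope quotient_scope.
Local Open Scope order_scope.

Record category := Category {
  obj :> Type;
  hom : obj -> obj -> Type;
  idm : forall x, hom x x;
  compm : forall x y z, hom y z -> hom x y -> hom x z;
  comp1m : forall x y (f : hom x y), compm (idm y) f = f;
  compm1 : forall x y (f : hom x y), compm f (idm x) = f;
  compmA : forall w x y z (h : hom y z) (g : hom x y) (f : hom w x),
    compm h (compm g f) = compm (compm h g) f }.

Declare Scope category_scope.
Delimit Scope category_scope with cat.
Notation "g ∘ f" := (compm g f) (at level 40, left associativity)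
  : category_scope.
Local Open Scope category_scope.

Definition opposite (C : category) : category :=
  @Category C (fun x y => hom y x) (@idm C) (fun x y z g f => f ∘ g)
    (fun x y f => compm1 f) (fun x y f => comp1m f)
    (fun w x y z h g f => esym (compmA f g h)).

Record functor (C D : category) := Functor {
  fobj :> C -> D;
  fmap : forall x y : C, hom x y -> hom (fobj x) (fobj y);
  fmap_id : forall x, fmap (idm x) = idm (fobj x);
  fmap_comp : forall (x y z : C) (g : hom y z) (f : hom x y),
    fmap (g ∘ f) = fmap g ∘ fmap f }.

Definition functor_id (C : category) : functor C C :=
  @Functor C C id (fun x y f => f) (fun _ => erefl) (fun _ _ _ _ _ => erefl).

Definition functor_comp (C D E : category)
    (G : functor D E) (F : functor C D) : functor C E :=
  @Functor C E (fun x => G (F x)) (fun x y f => fmap G (fmap F f))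
    (fun x => etrans (congr1 _ (fmap_id F x)) (fmap_id G (F x)))
    (fun x y z g f => etrans (congr1 _ (fmap_comp F g f)) (fmap_comp G _ _)).

Record nat_trans (C D : category) (F G : functor C D) := NatTrans {
  ntc :> forall x : C, hom (F x) (G x);
  ntc_natural : forall (x y : C) (f : hom x y),
    fmap G f ∘ ntc x = ntc y ∘ fmap F f }.

Lemma nat_trans_eq (C D : category) (F G : functor C D) (a b : nat_trans F G) :
  (forall x, a x = b x) -> a = b.
Proof.
case: a b => [a na] [b nb] /= ab.
have {}ab : a = b by apply: functional_extensionality_dep.
by subst b; congr NatTrans; apply: Prop_irrelevance.
Qed.

Definition is_iso (C : category) (x y : C) (f : hom x y) :=
  exists g : hom y x, g ∘ f = idm x /\ f ∘ g = idm y.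

Definition naturally_isomorphic (C D : category) (F G : functor C D) :=
  exists a : nat_trans F G, forall x, is_iso (a x).

Definition equivalent_categories (C D : category) :=
  exists (F : functor C D) (G : functor D C),
    naturally_isomorphic (functor_comp G F) (functor_id C) /\
    naturally_isomorphic (functor_comp F G) (functor_id D).

Definition SET : category :=
  @Category Type (fun A B => A -> B) (fun A => id) (fun A B C g f => g \o f)
    (fun _ _ _ => erefl) (fun _ _ _ => erefl) (fun _ _ _ _ _ _ _ => erefl).

HB.mixin Record isSkewLattice (S : Type) := {
  smeet : S -> S -> S;
  sjoin : S -> S -> S;
  szero : S;
  smeetA : associative smeet;
  sjoinA : associative sjoin;
  smeetxx : forall x, smeet x x = x;
  sjoinxx : forall x, sjoin x x = x;
  sjoinKI : forall x y, smeet x (sjoin x y) = x;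
  smeetKU : forall x y, sjoin x (smeet x y) = x;
  sjoinIK : forall x y, smeet (sjoin y x) x = x;
  smeetUK : forall x y, sjoin (smeet y x) x = x;
  smeetx0 : forall x, smeet x szero = szero;
  smeet0x : forall x, smeet szero x = szero
}.

#[short(type="skewLatticeType")]
HB.structure Definition SkewLattice := { S of isSkewLattice S }.

Declare Scope skew_scope.
Delimit Scope skew_scope with skew.
Notation "x ⊓ y" := (smeet x y) (at level 40, left associativity) : skew_scope.
Notation "x ⊔ y" := (sjoin x y) (at level 50, left associativity) : skew_scope.
Local Open Scope skew_scope.

Definition strongly_distributive (S : skewLatticeType) :=
  (forall x y z : S, x ⊓ (y ⊔ z) = (x ⊓ y) ⊔ (x ⊓ z)) /\
  (forall x y z : S, (y ⊔ z) ⊓ x = (y ⊓ x) ⊔ (z ⊓ x)).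

Definition left_handed (S : skewLatticeType) :=
  forall x y : S, x ⊓ y ⊓ x = x ⊓ y.

Definition greenD (S : skewLatticeType) (x y : S) :=
  x ⊓ y ⊓ x = x /\ y ⊓ x ⊓ y = y.

Section Band.
Variables (T : Type) (op : T -> T -> T).
Hypotheses (opA : associative op) (opxx : forall x, op x x = x).
Local Notation "x * y" := (op x y).

Definition bandD x y := x * y * x = x /\ y * x * y = y.

Let opK x y : x * (x * y) = x * y. Proof. by rewrite opA opxx. Qed.

Lemma band_factor x a y b : x = a * y * b -> x * y * x = x.
Proof.
move=> xE; set p := a * y; set q := y * b.
have xpq : x = p * q by rewrite xE /p /q -!opA opK.
have pz t : p * (y * (p * t)) = p * t.
  by rewrite /p -!opA opK; have := opK (a * y) t; rewrite -!opA.
have wq : q * (y * q) = q by rewrite /q -!opA opK; have := opxx (y * b); rewrite -!opA.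
clearbody p q; set u := y * p * q * y.
transitivity (p * (u * u) * q).
  by rewrite xpq /u -!opA opK pz wq.
by rewrite opxx /u -!opA pz wq.
Qed.

Lemma bandD_refl x : bandD x x. Proof. by split; rewrite !opxx. Qed.

Lemma bandD_sym x y : bandD x y -> bandD y x. Proof. by case. Qed.

Lemma bandD_trans y x z : bandD x y -> bandD y z -> bandD x z.
Proof.
move=> [xy yx] [yz zy]; split.
  apply: (@band_factor _ (x * y) _ (y * x)).
  have -> : x * y * z * (y * x) = x * (y * z * y) * x by rewrite !opA.
  by rewrite yz xy.
apply: (@band_factor _ (z * y) _ (y * z)).
have -> : z * y * x * (y * z) = z * (y * x * y) * z by rewrite !opA.
by rewrite yx zy.
Qed.

Lemma bandDC x y : bandD (x * y) (y * x).
Proof.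
split; first by apply: (@band_factor _ x _ y); rewrite -[LHS]opxx !opA.
by apply: (@band_factor _ y _ x); rewrite -[LHS]opxx !opA.
Qed.

Let mulr x y z : x * y * x = x -> (x * z) * (y * z) * (x * z) = x * z.
Proof.
move=> xyx; have [zx _] := bandDC (z * x) y.
apply: (@band_factor _ (x * (z * x * y)) _ (x * (z * x * y) * (x * z))).
have -> : x * (z * x * y) * (y * z) * (x * (z * x * y) * (x * z)) =
    x * (z * x * y * (y * (z * x)) * (z * x * y)) * (x * z) by rewrite !opA.
rewrite zx.
have -> : x * (z * x * y) * (x * z) = x * z * (x * y * x) * z by rewrite !opA.
by rewrite xyx; have := opxx (x * z); rewrite -!opA.
Qed.

Lemma bandD_mulr x y z : bandD x y -> bandD (x * z) (y * z).
Proof. by case=> xy yx; split; apply: mulr. Qed.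

End Band.

Lemma bandD_mull (T : Type) (op : T -> T -> T) (opA : associative op)
    (opxx : forall x, op x x = x) (x y z : T) :
  bandD op x y -> bandD op (op z x) (op z y).
Proof.
have opA' : associative (fun a b => op b a) by move=> a b c; rewrite opA.
move=> [xy yx]; have [] := @bandD_mulr T (fun a b => op b a) opA' opxx x y z.
  by split; rewrite opA.
by rewrite /bandD !opA.
Qed.

Section GreenD.
Variable S : skewLatticeType.
Implicit Types x y z : S.

Lemma greenD_joinP x y : greenD x y <-> bandD (@sjoin S) x y.
Proof.
suff aux (m j : S -> S -> S) : associative m -> associative j ->
    (forall a, m a a = a) -> (forall a, j a a = a) ->
    (forall a b, j a (m a b) = a) -> (forall a b, j (m b a) a = a) ->
    forall a b, bandD m a b -> bandD j a b.
  split; apply: aux; [exact: smeetA|exact: sjoinA|exact: smeetxx|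
    exact: sjoinxx|exact: smeetKU|exact: smeetUK|exact: sjoinA|exact: smeetA|
    exact: sjoinxx|exact: smeetxx|exact: sjoinKI|exact: sjoinIK].
move=> mA jA mxx jxx K1 K2 a b [ab ba].
pose c := m a b.
have ac : bandD j a c.
  have jac : j a c = a by rewrite K1.
  have jca : j c a = c.
    by rewrite -[X in j c X]ab -/c; have := K1 c a.
  by split; rewrite ?jac ?jca ?jxx.
have cb : bandD j c b.
  have jcb : j c b = b by rewrite K2.
  have jbc : j b c = c.
    rewrite -[X in j X c]ba -mA; exact: K2.
  by split; rewrite ?jcb ?jbc ?jxx.
exact: bandD_trans ac cb.
Qed.

Lemma greenD_meet x x' y y' :
  greenD x x' -> greenD y y' -> greenD (x ⊓ y) (x' ⊓ y').
Proof.
move=> xx' yy'; apply: (@bandD_trans _ _ (@smeetA S) (@smeetxx S) (x' ⊓ y)).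
  exact: (bandD_mulr (@smeetA S) (@smeetxx S)).
exact: (bandD_mull (@smeetA S) (@smeetxx S)).
Qed.

Lemma greenD_join x x' y y' :
  greenD x x' -> greenD y y' -> greenD (x ⊔ y) (x' ⊔ y').
Proof.
move=> /greenD_joinP xx' /greenD_joinP yy'; apply/greenD_joinP.
apply: (@bandD_trans _ _ (@sjoinA S) (@sjoinxx S) (x' ⊔ y)).
  exact: (bandD_mulr (@sjoinA S) (@sjoinxx S)).
exact: (bandD_mull (@sjoinA S) (@sjoinxx S)).
Qed.

(* [{classic S}] only equips [S] with the choice structure that [{eq_quot _}]
   asks for. *)
Definition greenDb : rel {classic S} := fun x y => `[< @greenD S x y >].

Lemma greenDb_refl : reflexive greenDb.
Proof. by move=> x; apply/asboolP; apply: bandD_refl; exact: smeetxx. Qed.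

Lemma greenDb_sym : symmetric greenDb.
Proof. by move=> x y; apply/asboolP/asboolP; exact: bandD_sym. Qed.

Lemma greenDb_trans : transitive greenDb.
Proof.
move=> y x z /asboolP xy /asboolP yz; apply/asboolP.
exact: (bandD_trans (@smeetA S) (@smeetxx S) xy yz).
Qed.

Definition greenD_equiv : equiv_rel {classic S} :=
  EquivRel greenDb greenDb_refl greenDb_sym greenDb_trans.

End GreenD.

Definition quotD (S : skewLatticeType) : Type := {eq_quot (greenD_equiv S)}.

Definition classD (S : skewLatticeType) (x : S) : quotD S :=
  \pi_{eq_quot (greenD_equiv S)} (x : {classic S}).

Definition reprD (S : skewLatticeType) (a : quotD S) : S :=
  repr (a : {eq_quot (greenD_equiv S)}).

(* Displays only select printing notations. *)
Fact quotD_display : Order.disp_t. Proof. exact: Order.Disp tt tt. Qed.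

Section QuotD.
Variable S : skewLatticeType.
Implicit Types (x y z : S) (a b c : quotD S).

HB.instance Definition _ := Choice.on (quotD S).

Lemma reprDK a : classD (reprD a) = a. Proof. exact: reprK. Qed.

Lemma classDP x y : classD x = classD y <-> greenD x y.
Proof.
split; first by move=> /(@eqmodP _ (greenD_equiv S)) /asboolP.
by move=> xy; apply/(@eqmodP _ (greenD_equiv S))/asboolP.
Qed.

Definition meetD a b := classD (reprD a ⊓ reprD b).
Definition joinD a b := classD (reprD a ⊔ reprD b).

Lemma classD_meet x y : classD (x ⊓ y) = meetD (classD x) (classD y).
Proof. by apply/classDP/greenD_meet; apply/classDP; rewrite reprDK. Qed.

Lemma classD_join x y : classD (x ⊔ y) = joinD (classD x) (classD y).
Proof. by apply/classDP/greenD_join; apply/classDP; rewrite reprDK. Qed.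

Let meetDC : commutative meetD.
Proof.
by move=> a b; apply/classDP; exact: (bandDC (@smeetA S) (@smeetxx S)).
Qed.

Let joinDC : commutative joinD.
Proof.
by move=> a b; apply/classDP/greenD_joinP; exact: (bandDC (@sjoinA S) (@sjoinxx S)).
Qed.

Let meetDA : associative meetD.
Proof.
move=> a b c; rewrite -[a]reprDK -[b]reprDK -[c]reprDK -!classD_meet.
by rewrite smeetA.
Qed.

Let joinDA : associative joinD.
Proof.
move=> a b c; rewrite -[a]reprDK -[b]reprDK -[c]reprDK -!classD_join.
by rewrite sjoinA.
Qed.

Let joinDKI b a : meetD a (joinD a b) = a.
Proof.
by rewrite -[a]reprDK -[b]reprDK -classD_join -classD_meet sjoinKI.
Qed.

Let meetDKU b a : joinD a (meetD a b) = a.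
Proof.
by rewrite -[a]reprDK -[b]reprDK -classD_meet -classD_join smeetKU.
Qed.

Let meetDxx a : meetD a a = a.
Proof. by rewrite /meetD smeetxx reprDK. Qed.

Definition leD : rel (quotD S) := fun a b => meetD a b == a.

Let leD_refl : reflexive leD. Proof. by move=> a; apply/eqP. Qed.

Let leD_anti : antisymmetric leD.
Proof. by move=> a b /andP[/eqP ab /eqP ba]; rewrite -ba meetDC ab. Qed.

Let leD_trans : transitive leD.
Proof.
by move=> b a c /eqP ab /eqP bc; apply/eqP; rewrite -ab -meetDA bc.
Qed.

HB.instance Definition _ := Order.Le_isPOrder.Build quotD_display (quotD S)
  leD_refl leD_anti leD_trans.

HB.instance Definition _ := Order.POrder_isLattice.Build quotD_display (quotD S)
  meetDC joinDC meetDA joinDA joinDKI meetDKU (fun _ _ => erefl).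

End QuotD.

Definition proper_map (d1 d2 : Order.disp_t) (L1 : latticeType d1)
    (L2 : latticeType d2) (k : L1 -> L2) :=
  forall y : L2, exists x : L1, y <= k x.

(* The value does not depend on the representative when [h] is a homomorphism
   (see [classD_map]). *)
Definition quotD_map (S T : skewLatticeType) (h : S -> T) :
  quotD S -> quotD T := fun a => classD (h (reprD a)).

Record skew_hom (S T : skewLatticeType) (h : S -> T) : Prop := SkewHom {
  skew_hom_meet : {morph h : x y / x ⊓ y};
  skew_hom_join : {morph h : x y / x ⊔ y};
  skew_hom_zero : h (szero : S) = szero }.

Section QuotDMap.
Variables (S T : skewLatticeType) (h : S -> T).
Hypothesis hh : skew_hom h.

Lemma classD_map (x : S) : quotD_map h (classD x) = classD (h x).
Proof.
have /classDP[h1 h2] := reprDK (classD x); apply/classDP.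
by split; rewrite -!(skew_hom_meet hh) (h1, h2).
Qed.

Lemma quotD_map_meet : {morph quotD_map h : a b / a `&` b}.
Proof.
move=> a b; rewrite -[a]reprDK -[b]reprDK -[LHS]/(quotD_map h (meetD _ _)).
rewrite -[RHS]/(meetD _ _) -classD_meet !classD_map -classD_meet.
by rewrite (skew_hom_meet hh).
Qed.

Lemma quotD_map_join : {morph quotD_map h : a b / a `|` b}.
Proof.
move=> a b; rewrite -[a]reprDK -[b]reprDK -[LHS]/(quotD_map h (joinD _ _)).
rewrite -[RHS]/(joinD _ _) -classD_join !classD_map -classD_join.
by rewrite (skew_hom_join hh).
Qed.

End QuotDMap.

Definition proper_skew_hom (S T : skewLatticeType) (h : S -> T) :=
  proper_map (quotD_map h).

Record sdl := Sdl {
  sdl_sort :> skewLatticeType;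
  sdl_distributive : strongly_distributive sdl_sort;
  sdl_left_handed : left_handed sdl_sort }.

Record sdl_hom (S T : sdl) := SdlHom {
  sdl_fun :> S -> T;
  sdl_fun_hom : skew_hom sdl_fun;
  sdl_fun_proper : proper_skew_hom sdl_fun }.

Lemma sdl_hom_eq (S T : sdl) (f g : sdl_hom S T) : f =1 g -> f = g.
Proof.
case: f g => [f f1 f2] [g g1 g2] /= /funext fg; subst g.
by congr SdlHom; apply: Prop_irrelevance.
Qed.

Lemma skew_hom_id (S : skewLatticeType) : skew_hom (@id S).
Proof. by []. Qed.

Lemma proper_skew_hom_id (S : skewLatticeType) : proper_skew_hom (@id S).
Proof. by move=> a; exists a; rewrite /quotD_map /= reprDK. Qed.

Lemma skew_hom_comp (S T U : skewLatticeType) (g : T -> U) (f : S -> T) :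
  skew_hom g -> skew_hom f -> skew_hom (g \o f).
Proof.
move=> [gm gj g0] [fm fj f0].
by split=> [x y|x y|] /=; rewrite ?fm ?gm ?fj ?gj ?f0.
Qed.

Lemma proper_skew_hom_comp (S T U : skewLatticeType) (g : T -> U) (f : S -> T) :
  skew_hom g -> proper_skew_hom g -> proper_skew_hom f ->
  proper_skew_hom (g \o f).
Proof.
move=> gh gp fp c.
have [b cb] := gp c; have [a ba] := fp b; exists a.
rewrite /quotD_map /= -(classD_map gh); apply: (le_trans cb).
rewrite -[classD _]/(quotD_map f a) leEmeet.
by rewrite -(quotD_map_meet gh) (meet_l ba).
Qed.

Definition sdl_id (S : sdl) : sdl_hom S S :=
  SdlHom (@skew_hom_id S) (@proper_skew_hom_id S).

Definition sdl_comp (S T U : sdl) (g : sdl_hom T U) (f : sdl_hom S T) :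
    sdl_hom S U :=
  SdlHom (skew_hom_comp (sdl_fun_hom g) (sdl_fun_hom f))
    (proper_skew_hom_comp (sdl_fun_hom g) (sdl_fun_proper g) (sdl_fun_proper f)).

Definition SDL : category.
Proof.
refine (@Category sdl sdl_hom sdl_id sdl_comp _ _ _);
  by move=> *; apply: sdl_hom_eq.
Defined.

Definition upset d (X : porderType d) (U : set X) :=
  forall x y : X, x <= y -> U x -> U y.

Definition downset d (X : porderType d) (U : set X) :=
  forall x y : X, x <= y -> U y -> U x.

Definition priestley d (X : POrderedTopological.type d) :=
  compact [set: X] /\
  forall x y : X, ~~ (x <= y) -> exists U V : set X,
    [/\ clopen U /\ clopen V, upset U, downset V, U `&` V = set0 & U x /\ V y].

(* In the topology of [one_point_compactification], the neighbourhoods of the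
   added point [None] are the sets containing [None] and the complement of a
   closed compact set, so [U] is open iff [Some @^-1` U] is open and, when
   [None \in U], the complement of [Some @^-1` U] is closed and compact. *)
Definition ordered_opc d (X : POrderedTopological.type d) : Type :=
  one_point_compactification X.

Section OrderedOpc.
Variables (d : Order.disp_t) (X : POrderedTopological.type d).

HB.instance Definition _ :=
  Topological.copy (ordered_opc X) (one_point_compactification X).

Definition opc_le (x y : ordered_opc X) : bool :=
  match x, y with
  | _, None => true
  | None, Some _ => false
  | Some a, Some b => a <= b
  end.

Let opc_le_refl : reflexive opc_le. Proof. by case=> /=. Qed.

Let opc_le_anti : antisymmetric opc_le.
Proof. by case=> [x|] [y|] //= /le_anti ->. Qed.

Let opc_le_trans : transitive opc_le.
Proof. by case=> [x|] [y|] [z|] //=; apply: le_trans. Qed.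

HB.instance Definition _ := Order.Le_isPOrder.Build d (ordered_opc X)
  opc_le_refl opc_le_anti opc_le_trans.

End OrderedOpc.

Fact lps_display : Order.disp_t. Proof. exact: Order.Disp tt tt. Qed.

Record lps := Lps {
  lps_sort :> POrderedTopological.type lps_display;
  lps_priestley : priestley (ordered_opc lps_sort) }.

(* [h] is an extension of [f] to the ordered one-point-compactifications. *)
Definition lps_hom_ext (X Y : lps) (f : X -> Y)
    (h : ordered_opc X -> ordered_opc Y) :=
  [/\ continuous h, {homo h : x y / x <= y}, h @^-1` [set None] = [set None]
    & forall x, h (Some x) = Some (f x)].

Record lps_hom (X Y : lps) := LpsHom {
  lps_fun :> X -> Y;
  lps_fun_ext : exists h, lps_hom_ext lps_fun h }.

Lemma lps_hom_eq (X Y : lps) (f g : lps_hom X Y) : f =1 g -> f = g.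
Proof.
case: f g => [f f1] [g g1] /= /funext fg; subst g.
by congr LpsHom; apply: Prop_irrelevance.
Qed.

Lemma lps_id_ext (X : lps) : exists h, lps_hom_ext (@id X) h.
Proof. by exists id; split=> // x; apply: cvg_id. Qed.

Lemma lps_comp_ext (X Y Z : lps) (g : lps_hom Y Z) (f : lps_hom X Y) :
  exists h, lps_hom_ext (g \o f) h.
Proof.
case: g f => [g [k [kc kh k0 kS]]] [f [h [hc hh h0 hS]]] /=.
exists (k \o h); split.
- by move=> x; apply: continuous_comp; [exact: hc|exact: kc].
- by move=> x y xy; apply/kh/hh.
- by rewrite comp_preimage k0 h0.
- by move=> x /=; rewrite hS kS.
Qed.

Definition lps_id (X : lps) : lps_hom X X := LpsHom (lps_id_ext X).

Definition lps_comp (X Y Z : lps) (g : lps_hom Y Z) (f : lps_hom X Y) :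
  lps_hom X Z := LpsHom (lps_comp_ext g f).

Definition LPS : category.
Proof.
refine (@Category lps lps_hom lps_id lps_comp _ _ _);
  by move=> *; apply: lps_hom_eq.
Defined.

Lemma lps_hom_continuous (X Y : lps) (f : lps_hom X Y) : continuous f.
Proof.
case: f => f [h [hc _ _ hS]] x /= U Ufx.
have /hc : nbhs (h (Some x)) ((@Some Y) @` U : set (ordered_opc Y)).
  rewrite hS; exact: (@one_point_compactification_some_nbhs Y).
move=> /(@one_point_compactification_some_continuous X) hU.
suff : nbhs x (f @^-1` U) by [].
by apply: (@filterS _ (nbhs x)) hU => y [u Uu] /=; rewrite hS => -[<-].
Qed.
Arguments lps_hom_continuous {X Y} f.

Record opens (X : topologicalType) := Opens {
  oset :> set X;
  oset_open : open oset }.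

Definition Opens_cat (X : topologicalType) : category.
Proof.
refine (@Category (opens X) (fun U V => U `<=` V) (fun U => @subset_refl _ U)
  (fun U V W VW UV => subset_trans UV VW) _ _ _);
  by move=> * ; exact: (@Prop_irrelevance (_ `<=` _)).
Defined.

Definition presheaf (X : topologicalType) := functor (opposite (Opens_cat X)) SET.

Definition sections (X : topologicalType) (F : presheaf X) (U : opens X) : Type :=
  F U.

Definition restrict (X : topologicalType) (F : presheaf X) (U V : opens X)
  (UV : U `<=` V) : sections F V -> sections F U :=
  @fmap _ _ F V U UV.

Definition opens_setI (X : topologicalType) (U V : opens X) : opens X :=
  Opens (openI (oset_open U) (oset_open V)).

Lemma opens_subIl (X : topologicalType) (U V : opens X) : opens_setI U V `<=` U.
Proof. exact: subIsetl. Qed.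

Lemma opens_subIr (X : topologicalType) (U V : opens X) : opens_setI U V `<=` V.
Proof. exact: subIsetr. Qed.

(* [I] may be empty, so there is exactly one section over the empty set. *)
Definition is_sheaf (X : topologicalType) (F : presheaf X) :=
  forall (I : Type) (U : I -> opens X) (V : opens X) (UV : forall i, U i `<=` V),
    V `<=` \bigcup_i U i ->
  forall s : forall i, sections F (U i),
    (forall i j,
      restrict (@opens_subIl _ (U i) (U j)) (s i) =
      restrict (@opens_subIr _ (U i) (U j)) (s j)) ->
  exists! t : sections F V, forall i, restrict (UV i) t = s i.

Lemma restrict_id (X : topologicalType) (F : presheaf X) (U : opens X)
  (UU : U `<=` U) (s : sections F U) : restrict UU s = s.
Proof.
rewrite /restrict (_ : UU = idm (U : opposite (Opens_cat X))).
  by rewrite fmap_id.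
exact: (@Prop_irrelevance (_ `<=` _)).
Qed.

Lemma restrict_comp (X : topologicalType) (F : presheaf X) (U V W : opens X)
    (UV : U `<=` V) (VW : V `<=` W) (UW : U `<=` W) (s : sections F W) :
  restrict UV (restrict VW s) = restrict UW s.
Proof.
have -> : UW = subset_trans UV VW by exact: (@Prop_irrelevance (_ `<=` _)).
by rewrite /restrict -[RHS]/(@fmap _ _ F W U (compm (c := opposite (Opens_cat X)) UV VW) s)
  fmap_comp.
Qed.

Lemma restrict_trans (X : topologicalType) (F : presheaf X) (U V W : opens X)
    (UV : U `<=` V) (VW : V `<=` W) (s : sections F W) :
  restrict UV (restrict VW s) = restrict (subset_trans UV VW) s.
Proof. exact: restrict_comp. Qed.

Section Stalk.
Variables (X : topologicalType) (F : presheaf X) (x : X).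

Record local_section := LocalSection {
  ls_open : opens X;
  ls_mem : oset ls_open x;
  ls_section : sections F ls_open }.

Definition germ_eq (s t : local_section) :=
  exists (W : opens X) (Ws : W `<=` ls_open s) (Wt : W `<=` ls_open t),
    oset W x /\ restrict Ws (ls_section s) = restrict Wt (ls_section t).

Definition germ_eqb : rel {classic local_section} := fun s t => `[< germ_eq s t >].

Lemma germ_eqb_refl : reflexive germ_eqb.
Proof.
move=> s; apply/asboolP; exists (ls_open s), (@subset_refl _ _), (@subset_refl _ _).
by split=> //; exact: ls_mem.
Qed.

Lemma germ_eqb_sym : symmetric germ_eqb.
Proof.
by move=> s t; apply/asboolP/asboolP => -[W [Ws [Wt [Wx e]]]]; exists W, Wt, Ws.
Qed.

Lemma germ_eqb_trans : transitive germ_eqb.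
Proof.
move=> t s u /asboolP[W [Ws [Wt [Wx e]]]] /asboolP[W' [Wt' [Wu [W'x e']]]].
apply/asboolP; set I := opens_setI W W'.
have IW : I `<=` W by exact: opens_subIl.
have IW' : I `<=` W' by exact: opens_subIr.
exists I, (subset_trans IW Ws), (subset_trans IW' Wu); split=> //.
rewrite -(restrict_comp IW Ws) e -(restrict_comp IW' Wu) -e'.
by rewrite !(restrict_comp _ _ (subset_trans IW Wt)).
Qed.

Definition germ_equiv : equiv_rel {classic local_section} :=
  EquivRel germ_eqb germ_eqb_refl germ_eqb_sym germ_eqb_trans.

Definition stalk : Type := {eq_quot germ_equiv}.

End Stalk.

Definition global_support (X : topologicalType) (F : presheaf X) :=
  forall x : X, inhabited (stalk F x).

Section Pushforward.
Variables (X Y : topologicalType) (f : X -> Y) (f_cont : continuous f).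

Definition opens_preimage (V : opens Y) : opens X :=
  @Opens X (f @^-1` V) (proj1 (continuousP f) f_cont V (oset_open V)).

Definition opens_preimage_sub (U V : opens Y) (UV : U `<=` V) :
  opens_preimage U `<=` opens_preimage V := fun x => UV (f x).

Definition pushforward (F : presheaf X) : presheaf Y.
Proof.
refine (@Functor (opposite (Opens_cat Y)) SET
  (fun V => sections F (opens_preimage V))
  (fun V U (UV : U `<=` V) => restrict (opens_preimage_sub UV)) _ _).
- by move=> V; apply: funext => s; exact: restrict_id.
- move=> U V W VW UV; apply: funext => s.
  by symmetry; exact: restrict_comp.
Defined.

End Pushforward.

Record shlps := ShLps {
  sh_base : lps;
  sh_presheaf : presheaf sh_base;
  sh_is_sheaf : is_sheaf sh_presheaf;
  sh_global_support : global_support sh_presheaf }.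

Record shlps_hom (X Y : shlps) := ShLpsHom {
  sh_fun : lps_hom (sh_base X) (sh_base Y);
  sh_nat : nat_trans (sh_presheaf Y)
    (pushforward (lps_hom_continuous sh_fun) (sh_presheaf X)) }.

Definition lps_preimage (X Y : lps) (f : lps_hom X Y) : opens Y -> opens X :=
  opens_preimage (lps_hom_continuous f).

Definition sh_map (X Y : shlps) (f : shlps_hom X Y) (V : opens (sh_base Y)) :
    sections (sh_presheaf Y) V ->
    sections (sh_presheaf X) (lps_preimage (sh_fun f) V) :=
  sh_nat f V.

Lemma sh_map_restrict (X Y : shlps) (f : shlps_hom X Y)
    (U V : opens (sh_base Y)) (UV : U `<=` V)
    (UV' : lps_preimage (sh_fun f) U `<=` lps_preimage (sh_fun f) V)
    (s : sections (sh_presheaf Y) V) :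
  sh_map f (restrict UV s) = restrict UV' (sh_map f s).
Proof.
have := ntc_natural (sh_nat f) (UV : @hom (opposite (Opens_cat _)) V U).
move=> /(congr1 (fun h => h s)) e; refine (etrans (esym e) _).
rewrite -[LHS]/(restrict (opens_preimage_sub UV) (sh_map f s)).
by congr (restrict _ _); exact: (@Prop_irrelevance (_ `<=` _)).
Qed.

Arguments sh_map_restrict {X Y} f {U V}.

Lemma shlps_hom_eq (X Y : shlps) (a b : shlps_hom X Y) :
  sh_fun a =1 sh_fun b ->
  (forall (V : opens (sh_base Y))
      (ba : lps_preimage (sh_fun b) V `<=` lps_preimage (sh_fun a) V)
      (s : sections (sh_presheaf Y) V),
    restrict ba (sh_map a s) = sh_map b s) ->
  a = b.
Proof.
case: a b => [a la] [b lb] /= /lps_hom_eq ab; subst b => /= lab.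
congr ShLpsHom; apply: nat_trans_eq => V; apply: funext => s.
by rewrite -[RHS](lab V (@subset_refl _ _)) restrict_id.
Qed.

Section MkShlpsHom.
Variables (X Y : shlps) (f : lps_hom (sh_base X) (sh_base Y)).
Variable l : forall V : opens (sh_base Y),
  sections (sh_presheaf Y) V -> sections (sh_presheaf X) (lps_preimage f V).
Hypothesis l_natural : forall (U V : opens (sh_base Y)) (UV : U `<=` V)
  (UV' : lps_preimage f U `<=` lps_preimage f V) s,
  restrict UV' (l s) = l (restrict UV s).

Definition mk_shlps_hom : shlps_hom X Y :=
  @ShLpsHom X Y f (@NatTrans (opposite (Opens_cat (sh_base Y))) SET
    (sh_presheaf Y) (pushforward (lps_hom_continuous f) (sh_presheaf X)) l
    (fun V U UV => funext (fun s => l_natural UV (opens_preimage_sub UV) s))).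

End MkShlpsHom.

Definition shlps_id (X : shlps) : shlps_hom X X.
Proof.
refine (@mk_shlps_hom X X (lps_id (sh_base X))
  (fun V => @restrict _ _ (lps_preimage (lps_id (sh_base X)) V) V
     (@subset_refl _ V)) _).
move=> U V UV UV' s.
have UV2 : lps_preimage (lps_id (sh_base X)) U `<=` V by [].
by rewrite !(restrict_comp _ _ UV2).
Defined.

Definition lps_preimage_comp (X Y Z : lps) (g : lps_hom Y Z) (f : lps_hom X Y)
    (U : opens Z) :
  lps_preimage (lps_comp g f) U `<=` lps_preimage f (lps_preimage g U) :=
  @subset_refl _ _.

(* Restricting along [lps_preimage_comp] is the identity on underlying sets: both
   open sets are the preimage of [U] under the composite, but the two proofs of
   openness are not convertible. The same remark applies to [shlps_id]. *)
Definition shlps_comp (X Y Z : shlps) (g : shlps_hom Y Z) (f : shlps_hom X Y) :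
  shlps_hom X Z.
Proof.
refine (@mk_shlps_hom X Z (lps_comp (sh_fun g) (sh_fun f))
  (fun U s => restrict (@lps_preimage_comp _ _ _ (sh_fun g) (sh_fun f) U)
     (sh_map f (sh_map g s))) _).
move=> U V UV UV' s.
have gUV : lps_preimage (sh_fun g) U `<=` lps_preimage (sh_fun g) V.
  exact: opens_preimage_sub.
have fUV : lps_preimage (sh_fun f) (lps_preimage (sh_fun g) U) `<=`
    lps_preimage (sh_fun f) (lps_preimage (sh_fun g) V).
  exact: opens_preimage_sub.
have fgUV : lps_preimage (lps_comp (sh_fun g) (sh_fun f)) U `<=`
    lps_preimage (sh_fun f) (lps_preimage (sh_fun g) V) by [].
rewrite (sh_map_restrict g UV gUV) (sh_map_restrict f gUV fUV).
by rewrite !(restrict_comp _ _ fgUV).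
Defined.

Lemma sh_map_id (X : shlps) (V : opens (sh_base X)) s :
  sh_map (shlps_id X) s =
    @restrict _ _ (lps_preimage (lps_id (sh_base X)) V) V (@subset_refl _ V) s.
Proof. by []. Qed.

Lemma sh_map_comp (X Y Z : shlps) (g : shlps_hom Y Z) (f : shlps_hom X Y)
    (U : opens (sh_base Z)) (s : sections (sh_presheaf Z) U) :
  sh_map (shlps_comp g f) s =
    restrict (@lps_preimage_comp _ _ _ (sh_fun g) (sh_fun f) U)
      (sh_map f (sh_map g s)).
Proof. by []. Qed.

Definition ShLPS : category.
Proof.
refine (@Category shlps shlps_hom shlps_id shlps_comp _ _ _).
- move=> X Y f; apply: shlps_hom_eq => // V ba s.
  rewrite sh_map_comp sh_map_id.
  have fV : lps_preimage (sh_fun f) (lps_preimage (lps_id (sh_base Y)) V) `<=`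
    lps_preimage (sh_fun f) V by [].
  by rewrite (sh_map_restrict f _ fV) !restrict_trans restrict_id.
- move=> X Y f; apply: shlps_hom_eq => // V ba s.
  rewrite sh_map_comp sh_map_id.
  by rewrite !restrict_trans restrict_id.
- move=> W X Y Z h g f; apply: shlps_hom_eq => // V ba s.
  rewrite !sh_map_comp.
  have fV : lps_preimage (sh_fun f) (lps_preimage (lps_comp (sh_fun h) (sh_fun g)) V)
    `<=` lps_preimage (sh_fun f) (lps_preimage (sh_fun g) (lps_preimage (sh_fun h) V))
    by [].
  rewrite (sh_map_restrict f _ fV).
  rewrite !restrict_trans; congr (restrict _ _).
  exact: (@Prop_irrelevance (_ `<=` _)).
Defined.

(* Main.v *)
From HB Require Import structures.
From mathcomp Require Import all_boot all_order.
From mathcomp Require Import all_classical topology.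
Require Import Defs.

Set Implicit Arguments.
Unset Strict Implicit.
Unset Printing Implicit Defensive.

Import Order.TTheory.
Local Open Scope quotient_scope.
Local Open Scope order_scope.
Local Open Scope classical_set_scope.
Local Open Scope category_scope.
Local Open Scope skew_scope.

(** The duality is realised by one functor [csec_functor]. It sends a sheaf [F] on a
    local Priestley space [X] to the skew lattice [csec] of sections of [F] over
    compact open downsets: [p ⊓ q] is [p] restricted to the common domain, and
    [p ⊔ q] is the union of [p] and [q] in which [q] wins on the overlap. A
    morphism acts by pulling domains back and by mapping sections. The functor is
    fully faithful and essentially surjective, and this is enough
    ([fully_faithful_equivalence]).

    Sections are handled as partial functions: [germ] sends a point [x] to an
    optional element of the stalk at [x], sections of a sheaf are determined by
    their germs ([germ_ext]), and germs that locally come from sections glue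
    ([germ_glue]). Each skew lattice identity thereby reduces to an identity
    between partial functions at one point.

    Why the functor is full and faithful: by ordered separation and compactness,
    the differences of compact open downsets form a base ([codown_basis]), and the
    points of [X] are the prime filters of compact open downsets
    ([codown_prime_point]). As the stalks are non-empty, each compact open downset
    is the domain of some section ([csec_over]) and each germ extends to a
    section over a compact open downset ([cval_germ]). A homomorphism [h] between
    two skew lattices of sections thus determines a map of points: [x] goes to the
    prime filter of the domains of those [p] for which [h p] is defined at [x]. It
    also determines a map of germs, because the germ of [h p] at [x] depends only
    on the germ of [p] at the image of [x] ([cval_hom]).

    Why it is essentially surjective: the space attached to [S] is its set of
    prime filters, ordered by reverse inclusion, with the differences
    [basic c `\` basic d] as a base. The elements [a] and [b] have the same germ
    at [P] when [(a ⊓ c) ⊔ d = (b ⊓ c) ⊔ d] for some [c] in [P] and some [d] outside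
    [P], which says that they agree on [basic c `\` basic d]. Sending [a] to its
    germs at the points of [basic a] is injective by a prime filter theorem
    ([prime_filter_separation]), and surjective because, by compactness, a section
    over [basic u] is patched together from finitely many elements of [S]
    ([spec_unit_surj]). *)

(** * Fully faithful, essentially surjective functors *)

Section FullyFaithful.
Variables (C D : category) (G : functor D C).
Hypothesis G_full : forall x y (h : hom (G x) (G y)), exists f, fmap G f = h.
Hypothesis G_faithful :
  forall x y (f g : hom x y), fmap G f = fmap G g -> f = g.
Hypothesis G_surj : forall c, exists (x : D) (e : hom (G x) c), is_iso e.

(** The inverse functor takes chosen preimages of objects up to isomorphism, and
    acts on morphisms by conjugating with the chosen isomorphisms. *)
Lemma fully_faithful_equivalence : equivalent_categories C D.
Proof.
have ex c : exists x : {x : D & hom (G x) c &  hom c (G x)},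
    let: existT2 _ e e' := x in e' ∘ e = idm _ /\ e ∘ e' = idm _.
  by have [x [e [e' ee']]] := G_surj c; exists (existT2 _ _ x e e').
pose K0 c := sval (cid (ex c)).
have K0P c : let: existT2 x e e' := K0 c in e' ∘ e = idm _ /\ e ∘ e' = idm _.
  rewrite /K0; case: cid => -[x e e2] /= p. exact: p.
clearbody K0; clear ex.
pose K c : D := let: existT2 x _ _ := K0 c in x.
pose e c : hom (G (K c)) c :=
  match K0 c as k return hom (G (let: existT2 x _ _ := k in x)) c with
  | existT2 _ e _ => e end.
pose e' c : hom c (G (K c)) :=
  match K0 c as k return hom c (G (let: existT2 x _ _ := k in x)) with
  | existT2 _ _ e' => e' end.
have e'K c : e' c ∘ e c = idm _ by rewrite /e /e' /K; case: (K0 c) (K0P c) => ? ? ? [].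
have eK c : e c ∘ e' c = idm _ by rewrite /e /e' /K; case: (K0 c) (K0P c) => ? ? ? [].
clearbody e e' K; clear K0 K0P.
pose lift x y (h : hom (G x) (G y)) : hom x y := sval (cid (G_full h)).
have liftK x y (h : hom (G x) (G y)) : fmap G (lift _ _ h) = h.
  by rewrite /lift; case: cid.
pose F1 c d (h : hom c d) : hom (K c) (K d) := lift _ _ (e' d ∘ h ∘ e c).
have F1id c : F1 c c (idm c) = idm (K c).
  by apply: G_faithful; rewrite liftK fmap_id compm1 e'K.
have F1comp a b c (g : hom b c) (f : hom a b) : F1 _ _ (g ∘ f) = F1 _ _ g ∘ F1 _ _ f.
  apply: G_faithful; rewrite fmap_comp !liftK !compmA.
  by rewrite -(compmA _ (e b)) eK compm1.
exists (Functor F1id F1comp), G; split.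
  have nat a b (f : hom a b) : fmap (functor_id C) f ∘ e a =
      e b ∘ fmap (functor_comp G (Functor F1id F1comp)) f.
    by rewrite /= liftK !compmA eK comp1m.
  exists (@NatTrans _ _ (functor_comp G (Functor F1id F1comp)) (functor_id C) e nat).
  by move=> c; exists (e' c); split; [exact: e'K|exact: eK].
have nat a b (f : hom a b) : fmap (functor_id D) f ∘ lift _ _ (e (G a)) =
    lift _ _ (e (G b)) ∘ fmap (functor_comp (Functor F1id F1comp) G) f.
  by apply: G_faithful; rewrite /= !fmap_comp !liftK !compmA eK comp1m.
exists (@NatTrans _ _ (functor_comp (Functor F1id F1comp) G) (functor_id D)
  (fun x => lift _ _ (e (G x))) nat).
move=> x; exists (lift _ _ (e' (G x))).
by split; apply: G_faithful; rewrite fmap_comp fmap_id !liftK ?e'K ?eK.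
Qed.

End FullyFaithful.

(** * Left-handed strongly distributive skew lattices *)

(** The order induced on the lattice of D-classes; without left-handedness the
    defining equation would be [a ⊓ b ⊓ a = a]. *)
Notation "a ≼ b" := (smeet a b = a) (at level 70) : skew_scope.

(** The homomorphisms to the two-element lattice that are not constant, described
    by the elements sent to [1]. Such a set is a union of D-classes, so these are
    the prime filters of the lattice of D-classes. *)
Record prime_filter (S : skewLatticeType) (P : set S) : Prop := PrimeFilter {
  pf_inhabited : exists a, P a;
  pf_zero : ~ P (szero : S);
  pf_meet : forall a b, P (a ⊓ b) <-> P a /\ P b;
  pf_join : forall a b, P (a ⊔ b) <-> P a \/ P b }.

Section SkewAlgebra.
Variable S : skewLatticeType.
Hypotheses (SD : strongly_distributive S) (LH : left_handed S).
Implicit Types a b c d e u v w x y z : S.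

Let meetUr x y z : x ⊓ (y ⊔ z) = (x ⊓ y) ⊔ (x ⊓ z) := SD.1 x y z.
Let meetUl x y z : (y ⊔ z) ⊓ x = (y ⊓ x) ⊔ (z ⊓ x) := SD.2 x y z.

Lemma szero_join x : szero ⊔ x = x.
Proof. by have := smeetUK x szero; rewrite smeet0x. Qed.

Lemma sjoin_zero x : x ⊔ szero = x.
Proof. by have := smeetKU x szero; rewrite smeetx0. Qed.

Lemma sjoin_equiv u v : u ≼ v -> u ⊔ v = v.
Proof. by move=> uv; rewrite -{1}uv smeetUK. Qed.

(** [x ⊔ y] and [y ⊔ x] are D-equivalent, and joins in a D-class select the right
    argument. *)
Lemma sjoin_left_handed x y : x ⊔ y ⊔ x = y ⊔ x.
Proof.
have [] : greenD (x ⊔ y) (y ⊔ x).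
  exact/greenD_joinP/(bandDC (@sjoinA S) (@sjoinxx S)).
rewrite LH => /sjoin_equiv + _.
by rewrite sjoinA -(sjoinA x y y) sjoinxx.
Qed.

Lemma sle_trans b a c : a ≼ b -> b ≼ c -> a ≼ c.
Proof. by move=> ab bc; rewrite -{1}ab -smeetA bc. Qed.

Lemma sle_meetl a b : a ⊓ b ≼ a. Proof. exact: LH. Qed.

Lemma sle_meetr a b : a ⊓ b ≼ b. Proof. by rewrite -smeetA smeetxx. Qed.

Lemma sle_meet c a b : c ≼ a -> c ≼ b -> c ≼ a ⊓ b.
Proof. by move=> ca cb; rewrite smeetA ca. Qed.

Lemma sle_joinl a b : a ≼ a ⊔ b. Proof. exact: sjoinKI. Qed.

(** Two D-equivalent elements below [w] coincide: if [u] and [v] lie below [w],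
    then [w ⊔ u = w], and distributing [(w ⊔ u) ⊓ v] yields [v = v ⊔ u = u]. *)
Lemma normal_below u v w : u ≼ v -> v ≼ u -> u ≼ w -> v ≼ w ->
  w ⊓ u = u -> w ⊓ v = v -> u = v.
Proof.
move=> uv vu uw vw wu wv; have wu' : w ⊔ u = w by rewrite -wu smeetKU.
have := meetUl v w u; rewrite wu' wv uv.
by rewrite (sjoin_equiv vu) => ->.
Qed.

(** [w ⊓ u] is [w] restricted to the domain of [u], so it depends on the D-class
    of [u] only. *)
Lemma smeet_congr w u v : u ≼ v -> v ≼ u -> w ⊓ u = w ⊓ v.
Proof.
move=> uv vu; apply: (@normal_below _ _ w).
- by apply: sle_meet; [exact: sle_meetl|apply: sle_trans uv; exact: sle_meetr].
- by apply: sle_meet; [exact: sle_meetl|apply: sle_trans vu; exact: sle_meetr].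
- exact: sle_meetl.
- exact: sle_meetl.
- by rewrite smeetA smeetxx.
- by rewrite smeetA smeetxx.
Qed.

Lemma sle_joinr a b : b ≼ a ⊔ b.
Proof.
have [] : greenD (a ⊔ b) (b ⊔ a).
  exact/greenD_joinP/(bandDC (@sjoinA S) (@sjoinxx S)).
rewrite !LH => ab ba.
by rewrite (smeet_congr b ab ba) sjoinKI.
Qed.

Lemma sle_join a b c : a ≼ c -> b ≼ c -> a ⊔ b ≼ c.
Proof. by move=> ac bc; rewrite meetUl ac bc. Qed.

(** The cancellation law of distributive lattices persists in [S]: it says that
    two partial functions that agree on a domain and off it are equal. *)
Lemma skew_cancel e u v : u ⊓ e = v ⊓ e -> u ⊔ e = v ⊔ e -> u = v.
Proof.
move=> uve uve'.
(* On the domain of [e] the meet with [e] recovers [x], off it the join does. *)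
have key x : x = (x ⊔ e) ⊓ x ⊔ (x ⊓ e).
  rewrite meetUl smeetxx -sjoinA.
  rewrite (@sjoin_equiv (e ⊓ x) (x ⊓ e)) ?smeetKU //.
  by apply: sle_meet; [exact: sle_meetr|exact: sle_meetl].
have eu : e ⊓ u = e ⊓ v by rewrite -(LH e u) -smeetA uve smeetA LH.
rewrite [LHS]key uve uve' meetUl eu -sjoinA.
rewrite (@sjoin_equiv (e ⊓ v) (v ⊓ e)) -?meetUr ?uve' ?sjoinKI //.
by apply: sle_meet; [exact: sle_meetr|exact: sle_meetl].
Qed.

(** Think of [a ⊔ d = b ⊔ d] as saying that [a] and [b] agree off the domain of
    [d]. This follows once they agree off it both inside and outside the domain
    of [e]. *)
Lemma skew_agree_cases a b d e :
  (a ⊓ e) ⊔ d = (b ⊓ e) ⊔ d -> a ⊔ d ⊔ e = b ⊔ d ⊔ e -> a ⊔ d = b ⊔ d.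
Proof.
move=> h1 h2; apply: (@skew_cancel e) => //; rewrite !meetUl.
have dd x : x ⊓ e ⊔ d ⊓ e = (x ⊓ e ⊔ d) ⊓ e.
  by rewrite meetUl -smeetA smeetxx.
by rewrite !dd h1.
Qed.

Lemma skew_agree_mono x y a b : x ≼ y -> a ⊔ x = b ⊔ x -> a ⊔ y = b ⊔ y.
Proof. by move=> xy abx; rewrite -(sjoin_equiv xy) !sjoinA abx. Qed.

Lemma skew_agree_meet e y a b : a ⊔ y = b ⊔ y -> (a ⊓ e) ⊔ y = (b ⊓ e) ⊔ y.
Proof.
have key z : (z ⊓ e) ⊔ y = (z ⊔ y) ⊓ e ⊔ y.
  by rewrite meetUl -sjoinA (sjoin_equiv (sle_meetl y e)).
by move=> ab; rewrite (key a) (key b) ab.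
Qed.



(** Distinct elements can be told apart at a prime filter. A maximal ideal [I]
    such that [a ⊔ i <> b ⊔ i] for all [i] in [I] is prime: if [e] and [f] are not in
    [I] while [e ⊓ f] is, then by maximality [a] and [b] agree off [i ⊔ e] and off
    [j ⊔ f] for some [i] and [j] in [I], so by [skew_agree_cases] they agree off
    [i ⊔ j ⊔ (e ⊓ f)], which is in [I]. The complement of [I] is the prime filter
    sought. *)
Lemma prime_filter_separation a b : a <> b -> exists P : set S,
  [/\ prime_filter P, P (a ⊔ b) &
    forall c d, P c -> ~ P d -> (a ⊓ c) ⊔ d <> (b ⊓ c) ⊔ d].
Proof.
move=> ab.
pose ideal (I : set S) := [/\ forall i j, I i -> I j -> I (i ⊔ j),
  forall i x, I i -> x ≼ i -> I x & forall i, I i -> a ⊔ i <> b ⊔ i].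
have [|I [[IU Idown Iab] Imax]] := @Zorn_bigcup S ideal.
  move=> F Fi Ftot; split.
  - move=> i j [A FA Ai] [B FB Bj]; have [AB|BA] := Ftot _ _ FA FB.
      by exists B => //; case: (Fi _ FB) => h _ _; apply: h => //; exact: AB.
    by exists A => //; case: (Fi _ FA) => h _ _; apply: h => //; exact: BA.
  - move=> i x [A FA Ai] xi; exists A => //.
    by case: (Fi _ FA) => _ h _; exact: h xi.
  - by move=> i [A FA Ai]; case: (Fi _ FA) => _ _; exact.
have I0 : I szero.
  apply: contrapT => nI0; apply: (Imax (I `|` [set szero])).
    by split=> [x Ix|h]; [left|apply: nI0; apply: h; right].
  split.
  - move=> i j [Ii|->] [Ij|->]; rewrite ?szero_join ?sjoin_zero; first by left; exact: IU.
    + by left.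
    + by left.
    + by right.
  - move=> i x [Ii xi|->]; first by left; exact: Idown xi.
    by rewrite smeetx0 => <-; right.
  - by move=> i [Ii|->]; [exact: Iab|rewrite !sjoin_zero].
(* Maximality, applied to the ideal generated by [I] and [e]. *)
have out e : ~ I e -> exists2 i, I i & a ⊔ i ⊔ e = b ⊔ i ⊔ e.
  move=> nIe; apply: contrapT => noi.
  pose J := [set x | exists2 i, I i & x ≼ i ⊔ e].
  apply: (Imax J); first split.
  - by move=> i Ii; exists i => //; exact: sle_joinl.
  - by move=> h; apply/nIe/h; exists szero => //; exact: sle_joinr.
  split.
  - move=> x y [i Ii xi] [j Ij yj]; exists (i ⊔ j); first exact: IU.
    apply: sle_join.
      apply: sle_trans xi _; apply: sle_join; last exact: sle_joinr.
      by apply: (@sle_trans (i ⊔ j)); [exact: sle_joinl|exact: sle_joinl].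
    apply: sle_trans yj _; apply: sle_join; last exact: sle_joinr.
    by apply: (@sle_trans (i ⊔ j)); [exact: sle_joinr|exact: sle_joinl].
  - by move=> i x [j Ij ij] xi; exists j => //; exact: sle_trans ij.
  - move=> x [i Ii xi] abx; apply: noi; exists i => //.
    have abs z : z ⊔ i ⊔ e = z ⊔ x ⊔ (i ⊔ e).
      by rewrite -!sjoinA; congr (_ ⊔ _); rewrite [in RHS](sjoin_equiv xi).
    by rewrite !abs abx.
have nIab : ~ I (a ⊔ b).
  by move=> /Iab; rewrite sjoinA sjoinxx sjoinA sjoin_left_handed.
exists (fun x => ~ I x); split=> //.
- split.
  + by exists (a ⊔ b).
  + by move=> /(_ I0).
  + move=> e f; split=> [nef|[ne nf]].
      split=> [Ie|If]; apply: nef.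
        by apply: Idown Ie _; exact: sle_meetl.
      by apply: Idown If _; exact: sle_meetr.
    move=> Ief; have [i Ii abi] := out e ne; have [j Ij abj] := out f nf.
    pose d := i ⊔ j ⊔ (e ⊓ f).
    have Id : I d by exact: IU (IU _ _ Ii Ij) Ief.
    apply: (Iab _ Id).
    apply: (@skew_agree_cases _ _ _ e).
      apply: (@skew_agree_cases _ _ _ f).
        have efd z : z ⊓ e ⊓ f ≼ d.
          rewrite -(smeetA z); apply: sle_trans (sle_meetr _ _) _.
          exact: sle_joinr.
        by rewrite !sjoin_equiv.
      rewrite -!(sjoinA _ d); apply: skew_agree_meet.
      apply: (@skew_agree_mono (j ⊔ f)); last by rewrite !sjoinA.
      apply: sle_join; last exact: sle_joinr.
      apply: (sle_trans _ (sle_joinl _ _)); apply: (sle_trans _ (sle_joinl _ _)).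
      exact: sle_joinr.
    rewrite -!(sjoinA _ d); apply: (@skew_agree_mono (i ⊔ e)); last by rewrite !sjoinA.
    apply: sle_join; last exact: sle_joinr.
    by apply: (sle_trans _ (sle_joinl _ _)); rewrite /d -sjoinA; exact: sle_joinl.
  + move=> e f; split.
      by move=> nef; apply: contrapT => /not_orP [/contrapT ne /contrapT nf]; exact/nef/IU.
    move=> [ne|nf] Ief; [apply: ne|apply: nf]; apply: Idown Ief _.
      exact: sle_joinl.
    exact: sle_joinr.

- move=> c d nc /contrapT Id abcd.
  have [i Ii abi] := out c nc.
  apply: (Iab (d ⊔ i)); first exact: IU.
  apply: (@skew_agree_cases _ _ _ c).
    by rewrite !sjoinA abcd.
  rewrite -!(sjoinA _ (d ⊔ i)).
  apply: (@skew_agree_mono (i ⊔ c)); last by rewrite !sjoinA.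
  by have := sle_joinr d (i ⊔ c); rewrite sjoinA.
Qed.

End SkewAlgebra.

(** * Compact open downsets of local Priestley spaces *)

(** Finite subcovers in the form of an induction principle: a property that passes
    to finite unions and to subsets, and holds near each point of a compact set,
    holds for that set. Otherwise the relative complements of the sets with the
    property would generate a proper filter without cluster point. *)
Lemma compact_induction (X : topologicalType) (K : set X) (Phi : set X -> Prop) :
  compact K -> Phi set0 ->
  (forall A B, Phi A -> Phi B -> Phi (A `|` B)) ->
  (forall A B, A `<=` B -> Phi B -> Phi A) ->
  (forall x, K x -> exists2 W, nbhs x W & Phi W) -> Phi K.
Proof.
move=> cK P0 PU Psub Ploc; apply: contrapT => nPK.
pose F := [set A | Phi (K `\` A)].
have FF : ProperFilter F.
  apply: Build_ProperFilter_ex.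
    move=> A FA; apply: contrapT => nA; apply: nPK; apply: Psub FA => x Kx.
    by split=> // Ax; apply: nA; exists x.
  split.
  - by rewrite /F /= setDT.
  - by move=> A B FA FB; rewrite /F /= setDIr; exact: PU.
  - by move=> A B AB FA; apply: Psub FA; exact: setDS.
have [|x [Kx clx]] := cK F FF; first by rewrite /F /= setDv.
have [W Wx PW] := Ploc x Kx.
have [y [nWy Wy]] : ~` W `&` W !=set0.
  by apply: clx => //; apply: Psub PW => y [_ /contrapT].
exact: nWy.
Qed.

Definition codown d (X : POrderedTopological.type d) (U : set X) :=
  [/\ open U, compact U & downset U].

Section Cod.
Variables (d : Order.disp_t) (X : POrderedTopological.type d).
Implicit Types U V : set X.

Lemma codown0 : codown (set0 : set X).
Proof. by split=> //; [exact: open0|exact: compact0]. Qed.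

Lemma codownU U V : codown U -> codown V -> codown (U `|` V).
Proof.
move=> [oU cU dU] [oV cV dV]; split; [exact: openU|exact: compactU|].
by move=> x y xy [/(dU _ _ xy)|/(dV _ _ xy)]; [left|right].
Qed.

End Cod.

Section LocalPriestley.
Variable X : lps.
Implicit Types (x y : X) (U V : set X).

Let oX := @ordered_opc lps_display X.

(** A closed set that stays away from the added point lies in the compact set
    whose complement is a neighbourhood of that point. *)
Lemma compact_away_infinity (K : set X) (W : set oX) :
  closed K -> nbhs (None : oX) W -> (forall x, K x -> ~ W (Some x)) -> compact K.
Proof.
move=> clK [C [cC _] CW] KW; apply: (subclosed_compact clK cC) => x Kx.
by apply: contrapT => nCx; apply: (KW x Kx); apply: CW; left; exists x.
Qed.

Lemma codown_trace (V : set oX) : clopen V -> downset V -> ~ V None ->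
  codown (Some @^-1` V : set X) /\ closed (Some @^-1` V : set X).
Proof.
move=> [oV clV] dV nV.
have cS : continuous (Some : X -> oX) := @one_point_compactification_some_continuous X.
have clSV : closed (Some @^-1` V : set X) by move/continuous_closedP : cS; apply.
split=> //; split.
- by move/continuousP : cS; apply.
- apply: (@compact_away_infinity _ (~` V)) => //.
  + by apply: open_nbhs_nbhs; split => //; exact: closed_openC.
  + by move=> x Vx; exact.
- by move=> x y xy; apply: (dV (Some x) (Some y)).
Qed.

Lemma clopen_codown_separation x y : ~~ (x <= y) ->
  exists U, [/\ codown U, closed U, U y & ~ U x].
Proof.
move=> xy; have [_ /(_ (Some x) (Some y) xy)] := lps_priestley X.
move=> [U [V [[cU cV] uU dV UV [Ux Vy]]]].
have nV z : U z -> ~ V z.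
  by move=> Uz Vz; have : (U `&` V) z by []; rewrite [_ `&` _]UV.
have VN : ~ V None by move=> VN; apply: (nV _ Ux); exact: (dV (Some x) None).
have [codV clV] := codown_trace cV dV VN.
by exists (Some @^-1` V); split => // Vx; exact: (nV _ Ux).
Qed.

(** Separates [x] from the added point, which is not below [x]. *)
Lemma codown_cover x : exists2 U, codown U & U x.
Proof.
have [_ /(_ None (Some x) isT)] := lps_priestley X.
move=> [U [V [[cU cV] uU dV UV [Ux Vy]]]].
have VN : ~ V None by move=> VN; have : (U `&` V) None by []; rewrite [_ `&` _]UV.
by have [codV _] := codown_trace cV dV VN; exists (Some @^-1` V).
Qed.

Lemma lps_hausdorff : hausdorff_space X.
Proof.
have sep x y U : open U -> closed U -> U x -> cluster (nbhs x) y -> U y.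
  move=> oU clU Ux xy; apply: contrapT => nUy.
  have [z [Uz /(_ Uz)]] : U `&` ~` U !=set0; last by [].
  apply: xy; apply: open_nbhs_nbhs; split => //; exact: closed_openC.
move=> x y xy; apply/eqP; rewrite eq_le; apply/andP; split.
  apply: contrapT => /negP /clopen_codown_separation [U [[oU _ _] clU Uy nUx]].
  apply: nUx; apply: sep (Uy) _ => //.
  by move=> A B Ay Bx; rewrite setIC; exact: xy.
apply: contrapT => /negP /clopen_codown_separation [U [[oU _ _] clU Ux nUy]].
exact: nUy (sep _ _ _ oU clU Ux xy).
Qed.

Lemma codown_closed U : codown U -> closed U.
Proof. by move=> [_ cU _]; apply: compact_closed cU; exact: lps_hausdorff. Qed.

Lemma codownI U V : codown U -> codown V -> codown (U `&` V).
Proof.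
move=> cU cV; have [[oU kU dU] [oV kV dV]] := (cU, cV); split.
- exact: openI.
- apply: (subclosed_compact _ kU); last by move=> x [].
  by apply: closedI; exact: codown_closed.
- by move=> x y xy [/(dU _ _ xy) ? /(dV _ _ xy) ?].
Qed.

Lemma codown_separation x y : ~~ (x <= y) -> exists U, [/\ codown U, U y & ~ U x].
Proof. by move=> /clopen_codown_separation [U [cU _ Uy nUx]]; exists U. Qed.

Lemma nbhs_codown x U : codown U -> U x -> nbhs x U.
Proof. by move=> [oU _ _] Ux; apply: open_nbhs_nbhs; split. Qed.

Lemma nbhs_codownC x U : codown U -> ~ U x -> nbhs x (~` U).
Proof.
move=> /codown_closed clU nUx; apply: open_nbhs_nbhs; split=> //.
exact: closed_openC.
Qed.

Lemma codown_point_inj x y : (forall U, codown U -> U x <-> U y) -> x = y.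
Proof.
move=> xy; apply/eqP; rewrite eq_le; apply/andP; split;
  by apply: contrapT => /negP /codown_separation [U [cU Uy]]; apply; exact/(xy _ cU).
Qed.

(** Inside a compact open downset [A0] around [x], ordered separation puts each
    point [y <> x] into some [B] that misses [x], or out of some [A] that contains
    [x]; by compactness finitely many such sets exclude all of [A0 `\` O]. *)
Lemma codown_basis x (O : set X) : nbhs x O ->
  exists A B, [/\ codown A, codown B, A x, ~ B x & A `\` B `<=` O].
Proof.
rewrite nbhsE => -[O' [oO' O'x] O'O]; have [A0 cA0 A0x] := codown_cover x.
pose Phi W := exists A B, [/\ codown A, codown B, A x, ~ B x & W `&` A `<=` B].
have [A [B [cA cB Ax nBx AB]]] : Phi (A0 `\` O').
  apply: compact_induction.
  - apply: (@subclosed_compact _ _ A0); last by move=> y [].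
    + by rewrite setDE; apply: closedI; [exact: codown_closed|exact: open_closedC].
    + by case: cA0.
  - exists A0, set0; split=> //; exact: codown0.
  - move=> W W' [A [B [cA cB Ax nBx AB]]] [A' [B' [cA' cB' A'x nB'x AB']]].
    exists (A `&` A'), (B `|` B'); split; [exact: codownI|exact: codownU|by []|by case|].
    by move=> y [[Wy|Wy] [Ay A'y]]; [left; exact: AB|right; exact: AB'].
  - move=> W W' WW' [A [B [cA cB Ax nBx AB]]]; exists A, B; split=> //.
    by move=> y [/WW' ? ?]; apply: AB.
  - move=> y [A0y nO'y].
    have xy : ~ (x = y) by move=> xy; apply: nO'y; rewrite -xy.
    have [yx|] := boolP (y <= x); last first.
      move=> /codown_separation [U [cU Ux nUy]]; exists (~` U).
        exact: nbhs_codownC.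
      by exists U, set0; split=> //; [exact: codown0|rewrite setICl].
    have /codown_separation [U [cU Uy nUx]] : ~~ (x <= y).
      by apply/negP => xy'; apply/xy/eqP; rewrite eq_le xy' yx.
    exists U; first exact: nbhs_codown.
    by exists A0, U; split=> // z [].
exists (A `&` A0), B; split=> //; first exact: codownI.
move=> y [[Ay A0y] nBy]; apply: O'O; apply: contrapT => nO'y.
exact/nBy/AB.
Qed.

(** A point [x] with [P U <-> U x] is one that lies in the differences [A `\` B]
    for all [A] in [P] and [B] outside [P]. If there were none in [A0], then by
    compactness some [A0 `&` A] with [A] in [P] would be covered by one [B]
    outside [P], against the filter property. *)
Lemma codown_prime_point (P : set X -> Prop) : (exists2 U, codown U & P U) -> ~ P set0 ->
  (forall U V, codown U -> codown V -> P (U `&` V) <-> P U /\ P V) ->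
  (forall U V, codown U -> codown V -> P (U `|` V) <-> P U \/ P V) ->
  exists x, forall U, codown U -> P U <-> U x.
Proof.
move=> [A0 cA0 PA0] P0 PI PU.
pose Phi W := exists A B, [/\ codown A, codown B, P A, ~ P B & W `&` A `<=` B].
have nPhi : ~ Phi A0.
  move=> [A [B [cA cB PA nPB AB]]]; apply: nPB.
  have cAA : codown (A0 `&` A) by exact: codownI.
  have /(PI _ _ cAA cB) [] // : P (A0 `&` A `&` B).
  by rewrite (setIidl AB); apply/PI.
have [x A0x nW] : exists2 x, A0 x & forall W, nbhs x W -> ~ Phi W.
  apply: contrapT => nx; apply: nPhi; apply: compact_induction.
  - by case: cA0.
  - by exists A0, set0; split=> //; exact: codown0.
  - move=> W W' [A [B [cA cB PA nPB AB]]] [A' [B' [cA' cB' PA' nPB' AB']]].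
    exists (A `&` A'), (B `|` B'); split.
    + exact: codownI.
    + exact: codownU.
    + exact/PI.
    + by move=> /(PU _ _ cB cB') [].
    + by move=> y [[Wy|Wy] [Ay A'y]]; [left; exact: AB|right; exact: AB'].
  - move=> W W' WW' [A [B [cA cB PA nPB AB]]]; exists A, B; split=> //.
    by move=> y [/WW' ? ?]; apply: AB.
  - move=> x A0x; apply: contrapT => nW; apply: nx; exists x => // W xW PhiW.
    by apply: nW; exists W.
exists x => U cU; split=> [PU'|Ux].
  apply: contrapT => nUx; apply: (nW (~` U)).
    exact: nbhs_codownC.
  by exists U, set0; split=> //; [exact: codown0|rewrite setICl].
apply: contrapT => nPU; apply: (nW U).
  exact: nbhs_codown.
by exists A0, U; split=> // z [].
Qed.

Lemma compact_sub_codown (K : set X) : compact K -> exists2 U, codown U & K `<=` U.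
Proof.
move=> cK; apply: (@compact_induction X K (fun K => exists2 U, codown U & K `<=` U)) => //.
- by exists set0 => //; exact: codown0.
- move=> A B [U cU AU] [V cV BV]; exists (U `|` V); first exact: codownU.
  exact: setUSS.
- by move=> A B AB [U cU BU]; exists U => //; exact: subset_trans BU.
- move=> x _; have [U cU Ux] := codown_cover x; exists U; last by exists U.
  exact: nbhs_codown.
Qed.

End LocalPriestley.

(** The preimage stays away from the added point because the extension of [f] is
    continuous there and sends only the added point of [X] to that of [Y]. *)
Lemma codown_preimage (X Y : lps) (f : lps_hom X Y) (V : set Y) :
  codown V -> codown (f @^-1` V).
Proof.
move=> cV; have [oV kV dV] := cV.
have cf := lps_hom_continuous f.
case: f cf => f /= [h [hc hh h0 hS]] cf; split.
- by move/continuousP : cf; apply.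
- apply: (@compact_away_infinity X _ (h @^-1` (~` (Some @` V)))).
  + by move/continuous_closedP : cf; apply; exact: codown_closed.
  + have h0' : h None = None by have : [set None] (None : ordered_opc X) by []; rewrite -h0.
    suff : nbhs (h None) (~` (Some @` V)) by move/hc.
    rewrite h0'; exists V; first by split => //; exact: codown_closed.
    by move=> _ [[y nVy <-]|->] [z Vz] // [zy]; apply: nVy; rewrite -zy.
  + by move=> x Vx; apply; exists (f x).
- move=> x y xy; apply: dV.
  by have := hh (Some x) (Some y) xy; rewrite !hS.
Qed.

(** Compact open downsets determine order and topology, also at infinity: each
    compact set lies in one of them. So pulling them back is all that a morphism of
    local Priestley spaces has to do. *)
Lemma lps_hom_of_preimage (X Y : lps) (f : X -> Y) :
  (forall V, codown V -> codown (f @^-1` V)) -> exists h, lps_hom_ext f h.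
Proof.
move=> fcod; exists (fun x => omap f x); split=> //.
- case=> [x|] W /=.
    move=> /codown_basis [A [B [cA cB Afx nBfx AB]]].
    have nA : nbhs x (f @^-1` A) by exact: nbhs_codown (fcod _ cA) Afx.
    have nB : nbhs x (~` (f @^-1` B)) by exact: nbhs_codownC (fcod _ cB) nBfx.
    by apply: filterS2 nA nB => z /= Az nBz; exact: AB.
  move=> [C [kC clC] CW]; have [V cV CV] := compact_sub_codown kC.
  exists (f @^-1` V).
    by split; [case: (fcod _ cV)|exact: codown_closed (fcod _ cV)].
  move=> _ [[x nVx <-]|->] /=; apply: CW; last by right.
  by left; exists (f x) => // /CV.
- case=> [x|] [y|] //= xy; apply: contrapT => /negP /codown_separation.
  move=> [U [cU Ufy nUfx]]; apply: nUfx; have [_ _ h] := fcod _ cU.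
  exact: h xy Ufy.
- by apply/seteqP; split=> -[x|].
Qed.

(** * Sections as partial functions *)

Section Germ.
Variables (X : topologicalType) (F : presheaf X).
Implicit Types (U V W : opens X) (x y : X).

(** The value at [x] of a section, with [None] off its domain: this turns a section
    into a partial function, whose domain is part of its value. *)
Definition germ x U (s : sections F U) : option (stalk F x) :=
  match pselect (oset U x) with
  | left Ux => Some (\pi_{eq_quot (germ_equiv F x)} (LocalSection Ux s))
  | right _ => None
  end.

Lemma germ_out x U (s : sections F U) : ~ oset U x -> germ x s = None.
Proof. by rewrite /germ; case: pselect. Qed.

Lemma germ_in x U (s : sections F U) : oset U x -> germ x s <> None.
Proof. by rewrite /germ; case: pselect. Qed.

Lemma germ_dom x U V (s : sections F U) (t : sections F V) :
  germ x s = germ x t -> oset U x -> oset V x.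
Proof.
move=> e Ux; apply: contrapT => nVx; move: e; rewrite (germ_out t nVx).
exact: germ_in.
Qed.

Lemma germ_eqP x U V (s : sections F U) (t : sections F V) :
  oset U x -> germ x s = germ x t <->
  exists W (WU : W `<=` U) (WV : W `<=` V), oset W x /\ restrict WU s = restrict WV t.
Proof.
move=> Ux; split=> [e|[W [WU [WV [Wx e]]]]].
  have Vx := germ_dom e Ux; move: e; rewrite /germ.
  case: pselect => // Ux'; case: pselect => // Vx' [].
  by move=> /(@eqmodP _ (germ_equiv F x)) /asboolP.
have Vx := WV _ Wx; rewrite /germ.
case: pselect => // Ux'; case: pselect => // Vx'; congr Some.
by apply/(@eqmodP _ (germ_equiv F x))/asboolP; exists W, WU, WV.
Qed.

Lemma germ_restrict x U V (VU : V `<=` U) (s : sections F U) :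
  oset V x -> germ x (restrict VU s) = germ x s.
Proof.
move=> Vx; apply/germ_eqP => //; exists V, (@subset_refl _ V), VU.
by split=> //; rewrite restrict_id.
Qed.

Lemma germ_eq_near x U V (s : sections F U) (t : sections F V) :
  oset U x -> germ x s = germ x t ->
  exists W : opens X, [/\ oset W x, W `<=` U, W `<=` V &
    forall y, oset W y -> germ y s = germ y t].
Proof.
move=> Ux /germ_eqP -/(_ Ux) [W [WU [WV [Wx e]]]]; exists W; split=> // y Wy.
by rewrite -(germ_restrict WU s Wy) e germ_restrict.
Qed.

Hypothesis F_sheaf : is_sheaf F.

(** Sections with equal germs agree on a cover by open sets. *)
Lemma germ_ext U (s t : sections F U) :
  (forall x, oset U x -> germ x s = germ x t) -> s = t.
Proof.
move=> st.
pose I := {W : opens X | exists WU : W `<=` U, restrict WU s = restrict WU t}.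
have WU (i : I) : sval i `<=` U by case: i => W [].
have cov : U `<=` \bigcup_(i : I) sval i.
  move=> x Ux; have /germ_eqP -/(_ Ux) [W [WU1 [WU2 [Wx e]]]] := st x Ux.
  have iW : exists WU : W `<=` U, restrict WU s = restrict WU t.
    by exists WU1; rewrite e; congr (restrict _ _); exact: (@Prop_irrelevance (_ `<=` _)).
  by exists (exist _ W iW).
have [|r [_ r_uniq]] := F_sheaf WU cov (s := fun i => restrict (WU i) s).
  move=> i j; rewrite !restrict_trans; congr (restrict _ _).
  exact: (@Prop_irrelevance (_ `<=` _)).
rewrite -(r_uniq s) // -(r_uniq t) //.
move=> i; have [WU' e] := svalP i.
have -> : WU i = WU' by exact: (@Prop_irrelevance (_ `<=` _)).
by rewrite e.
Qed.

Lemma germ_glue U (g : forall x, option (stalk F x)) :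
  (forall x, oset U x -> exists W (s : sections F W),
    oset W x /\ forall y, oset W y -> oset U y -> germ y s = g y) ->
  exists s : sections F U, forall x, oset U x -> germ x s = g x.
Proof.
move=> gloc.
(* The cover consists of all local sections with the prescribed germs. *)
pose good (Ws : {W : opens X & sections F W}) := tag Ws `<=` U /\
   forall y, oset (tag Ws) y -> germ y (tagged Ws) = g y.
pose I := {Ws | good Ws}.
have cov : U `<=` \bigcup_(i : I) tag (sval i).
  move=> x Ux; have [W [s [Wx sg]]] := gloc x Ux.
  pose s' := restrict (@opens_subIl _ W U) s.
  have iW : good (existT _ _ s').
    split=> /= [y []//|y [Wy Uy]]; rewrite germ_restrict //; exact: sg.
  by exists (exist good _ iW).
have WU (i : I) : tag (sval i) `<=` U by case: i => W [].
have [|r [rP _]] := F_sheaf WU cov (s := fun i => tagged (sval i)).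
  move=> [[W s] /= [WU1 sg]] [[W' s'] /= [WU' s'g]] /=.
  by apply: germ_ext => y [Wy W'y]; rewrite !germ_restrict //= sg // s'g.
exists r => x Ux; have [i _ Wx] := cov x Ux.
rewrite -(germ_restrict (WU i) r Wx) rP.
by have [_] := svalP i; exact.
Qed.

Lemma local_section_at : global_support F ->
  forall x, exists U (s : sections F U), oset U x.
Proof.
move=> gF x; case: (gF x) => a.
by exists (ls_open (repr a)), (ls_section (repr a)); exact: ls_mem.
Qed.

End Germ.
Arguments germ_in {X F x U} s.
Arguments germ_out {X F x U} s.

(** * The skew lattice of sections over compact open downsets *)

Section CodSections.
Variable X : shlps.
Let F := sh_presheaf X.
Let F_sheaf : is_sheaf F := @sh_is_sheaf X.

Record csec := CSec {
  cs_open : opens (sh_base X);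
  cs_codown : codown (oset cs_open);
  cs_sec : sections F cs_open }.

Implicit Types (p q r : csec) (x : sh_base X).

Definition cdom p : set (sh_base X) := oset (cs_open p).
Definition cval p x : option (stalk F x) := germ x (cs_sec p).

Lemma cval_out p x : ~ cdom p x -> cval p x = None. Proof. exact: germ_out. Qed.

Lemma cval_in p x : cdom p x -> cval p x. Proof. by rewrite /cval /germ; case: pselect. Qed.

Lemma cvalP p x : cval p x <-> cdom p x.
Proof.
split; last exact: cval_in.
by move=> vp; apply: contrapT => /cval_out ep; rewrite ep in vp.
Qed.

Lemma csec_ext p q : (forall x, cval p x = cval q x) -> p = q.
Proof.
move=> pq.
have dpq : cdom p = cdom q.
  by apply/seteqP; split=> x /cvalP h; apply/cvalP; [rewrite -pq|rewrite pq].
move: pq dpq; rewrite /cval /cdom; case: p q => [U cU s] [V cV t] /= st UV.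
have {}UV : U = V.
  case: U V UV {cU cV s t st} => [U oU] [V oV] /= UV; subst V.
  by congr Opens; exact: Prop_irrelevance.
subst V; have -> : s = t by apply: germ_ext.
by congr CSec; exact: Prop_irrelevance.
Qed.

Definition csec_meet p q : csec :=
  @CSec (opens_setI (cs_open p) (cs_open q)) (codownI (cs_codown p) (cs_codown q))
    (restrict (@opens_subIl _ _ _) (cs_sec p)).

Definition opens_setU (U V : opens (sh_base X)) : opens (sh_base X) :=
  Opens (openU (oset_open U) (oset_open V)).

Definition override (T : Type) (a b : option T) := if b then b else a.
Definition restrict_to (T : Type) (a b : option T) := if b then a else None.

(** As [V] is clopen, [t] on [V] and [s] on [U `\` V] live on disjoint open sets,
    so they glue. *)
Lemma override_exists (U V : opens (sh_base X)) (s : sections F U)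
    (t : sections F V) : closed (oset V) ->
  exists r : sections F (opens_setU U V),
  forall x, oset (opens_setU U V) x -> germ x r = override (germ x s) (germ x t).
Proof.
move=> clV; apply: germ_glue => // x UVx; have [Vx|nVx] := pselect (oset V x).
  exists V, t; split=> // y Vy _; rewrite /override.
  by case: (germ y t) (germ_in t Vy).
have Ux : oset U x by case: UVx.
have oW : open (oset U `&` ~` oset V).
  by apply: openI; [exact: oset_open|exact: closed_openC].
have WU : Opens oW `<=` U by move=> y [].
exists (Opens oW), (restrict WU s); split=> // y Wy _.
by rewrite germ_restrict //; case: Wy => Uy nVy; rewrite /override (germ_out t nVy).
Qed.

Definition csec_join p q : csec :=
  @CSec (opens_setU (cs_open p) (cs_open q)) (codownU (cs_codown p) (cs_codown q))
    (sval (cid (override_exists (cs_sec p) (cs_sec q) (codown_closed (cs_codown q))))).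

Definition opens0 : opens (sh_base X) := Opens (@open0 (sh_base X)).

Lemma csec_zero_exists : exists s : sections F opens0,
  forall x, oset opens0 x -> germ x s = None.
Proof. by apply: germ_glue. Qed.

Definition csec_zero : csec :=
  @CSec opens0 (@codown0 _ (sh_base X)) (sval (cid csec_zero_exists)).

Lemma cval_zero x : cval csec_zero x = None. Proof. exact: cval_out. Qed.

Lemma cval_meet p q x : cval (csec_meet p q) x = restrict_to (cval p x) (cval q x).
Proof.
have [qx|nqx] := pselect (cdom q x); last first.
  by rewrite /restrict_to (cval_out nqx) cval_out // => -[_ /nqx].
rewrite /restrict_to cval_in //.
have [px|npx] := pselect (cdom p x); first by rewrite /cval germ_restrict.
by rewrite (cval_out npx) cval_out // => -[/npx].
Qed.

Lemma cval_join p q x : cval (csec_join p q) x = override (cval p x) (cval q x).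
Proof.
have [pqx|npqx] := pselect (cdom (csec_join p q) x).
  by rewrite [LHS]/cval /csec_join /=; case: cid => s /= ->.
rewrite cval_out // /override !cval_out // => [px|qx]; apply: npqx.
  by left.
by right.
Qed.

Definition cvalE := (cval_meet, cval_join, cval_zero).

Definition csec_skew_lattice : isSkewLattice csec.
Proof.
apply: (@isSkewLattice.Build csec csec_meet csec_join csec_zero);
  move=> *; apply: csec_ext => x; rewrite !cvalE /override /restrict_to;
  by do ![case: (cval _ x) => //].
Defined.
HB.instance Definition _ := csec_skew_lattice.

Lemma cval_smeet p q x : cval (p ⊓ q) x = restrict_to (cval p x) (cval q x).
Proof. exact: cval_meet. Qed.

Lemma cval_sjoin p q x : cval (p ⊔ q) x = override (cval p x) (cval q x).
Proof. exact: cval_join. Qed.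

Lemma cval_szero x : cval (szero : csec) x = None.
Proof. exact: cval_zero. Qed.

Lemma csec_strongly_distributive : strongly_distributive csec.
Proof.
by split=> p q r; apply: csec_ext => x; rewrite !(cval_smeet, cval_sjoin)
  /override /restrict_to; do ![case: (cval _ x) => //].
Qed.

Lemma csec_left_handed : left_handed csec.
Proof.
by move=> p q; apply: csec_ext => x; rewrite !cval_smeet /restrict_to;
  do ![case: (cval _ x) => //].
Qed.

Lemma cdom_meet p q x : cdom (p ⊓ q) x <-> cdom p x /\ cdom q x.
Proof. by []. Qed.

Lemma sle_dom p q : p ≼ q <-> cdom p `<=` cdom q.
Proof.
split=> [<- x /cdom_meet[] //|pq]; apply: csec_ext => x.
rewrite cval_smeet /restrict_to; case: ifPn => // /negP nq.
by rewrite cval_out // => /pq /cval_in.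
Qed.

(** Locally finite gluing: a compact open set carries a section because finitely
    many clopen sets carrying sections cover it. This is where non-empty stalks
    are used. *)
Lemma csec_over (U : set (sh_base X)) : codown U -> exists p, cdom p = U.
Proof.
move=> cU.
pose Phi W := exists O : opens (sh_base X),
  [/\ closed (oset O), W `<=` O & inhabited (sections F O)].
have [O [_ UO [s]]] : Phi U.
  apply: compact_induction.
  - by case: cU.
  - exists opens0; split=> //; first exact: closed0.
    by case: csec_zero_exists => s.
  - move=> A B [V [clV AV [s]]] [W [clW BW [t]]].
    exists (opens_setU V W); split; [exact: closedU|exact: setUSS|].
    by have [r _] := override_exists s t clW.
  - move=> A B AB [V [clV BV s]]; exists V; split=> //; exact: subset_trans BV.
  - move=> x _; have [V [s Vx]] := local_section_at (@sh_global_support X) x.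
    have [|A [B [cA cB Ax nBx AB]]] := @codown_basis _ x (oset V).
      by apply: open_nbhs_nbhs; split=> //; exact: oset_open.
    have oW : open (A `\` B).
      by rewrite setDE; apply: openI; [case: cA|exact: closed_openC (codown_closed cB)].
    exists (A `\` B).
      by apply: open_nbhs_nbhs.
    exists (Opens oW); split=> //.
      rewrite /= setDE; apply: closedI; first exact: codown_closed.
      by apply: open_closedC; case: cB.
    by exists; exact: (@restrict _ F (Opens oW) V AB s).
have cU' : open U by case: cU.
by exists (@CSec (Opens cU') cU (@restrict _ F (Opens cU') O UO s)).
Qed.

(** Near [x] the section [s] lives on a difference [A `\` B] of compact open
    downsets. The latter is clopen, so any section over [A] can be overridden by
    [s] there. *)
Lemma cval_germ (U : opens (sh_base X)) (s : sections F U) x : oset U x ->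
  exists p, cval p x = germ x s.
Proof.
move=> Ux; have [|A [B [cA cB Ax nBx AB]]] := @codown_basis _ x (oset U).
  by apply: open_nbhs_nbhs; split=> //; exact: oset_open.
have [p pA] := csec_over cA.
have oW : open (A `\` B).
  by rewrite setDE; apply: openI; [case: cA|exact: closed_openC (codown_closed cB)].
have clW : closed (A `\` B).
  rewrite setDE; apply: closedI; first exact: codown_closed.
  by apply: open_closedC; case: cB.
have Wx : oset (Opens oW) x by [].
have [r rP] := override_exists (cs_sec p) (@restrict _ F (Opens oW) U AB s) clW.
have pr : cs_open p `<=` opens_setU (cs_open p) (Opens oW) by move=> y; left.
have px : oset (cs_open p) x by rewrite -[oset _]/(cdom p) pA.
exists (CSec (cs_codown p) (restrict pr r)); rewrite /cval /= germ_restrict //.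
rewrite rP; last by left.
rewrite germ_restrict // /override.
by case: (germ x s) (germ_in s Ux).
Qed.

End CodSections.

(** * The functor of sections *)

Definition csec_sdl (X : shlps) : sdl :=
  Sdl (@csec_strongly_distributive X) (@csec_left_handed X).

Lemma classD_le (S : skewLatticeType) (LH : left_handed S) (a b : S) :
  classD a <= classD b <-> a ≼ b.
Proof.
rewrite -[_ <= _]/(meetD (classD a) (classD b) == classD a).
rewrite -classD_meet; split=> [/eqP/classDP[_]|->//].
by rewrite smeetA smeetxx LH.
Qed.

Lemma proper_skew_homP (S T : skewLatticeType) (h : S -> T) :
  left_handed T -> skew_hom h ->
  proper_skew_hom h <-> forall b, exists a, b ≼ h a.
Proof.
move=> LH hh; split=> [hp b|hp b].
  have [a ba] := hp (classD b); exists (reprD a).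
  by apply/(classD_le LH); rewrite -classD_map // reprDK.
have [a ba] := hp (reprD b); exists (classD a).
by rewrite classD_map // -[b]reprDK; apply/(classD_le LH).
Qed.



Lemma germ_sh_map (X Y : shlps) (f : shlps_hom X Y) (x : sh_base X)
    (U V : opens (sh_base Y)) (s : sections (sh_presheaf Y) U)
    (t : sections (sh_presheaf Y) V) :
  germ (sh_fun f x) s = germ (sh_fun f x) t ->
  germ x (sh_map f s) = germ x (sh_map f t).
Proof.
move=> st; have [Ufx|nUfx] := pselect (oset U (sh_fun f x)); last first.
  rewrite !germ_out // => /= Vfx; apply: nUfx.
  exact: germ_dom (esym st) Vfx.
move: st => /germ_eqP -/(_ Ufx) [W [WU [WV [Wx e]]]].
have fWU : lps_preimage (sh_fun f) W `<=` lps_preimage (sh_fun f) U.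
  by move=> z /WU.
have fWV : lps_preimage (sh_fun f) W `<=` lps_preimage (sh_fun f) V.
  by move=> z /WV.
have fWx : oset (lps_preimage (sh_fun f) W) x by [].
rewrite -(germ_restrict fWU _ fWx) -(germ_restrict fWV _ fWx).
by rewrite -!(sh_map_restrict f) e.
Qed.

Section CodSectionsMap.
Variables (X Y : shlps) (f : shlps_hom X Y).

Definition csec_map (p : csec Y) : csec X :=
  @CSec X (lps_preimage (sh_fun f) (cs_open p))
    (codown_preimage (sh_fun f) (cs_codown p)) (sh_map f (cs_sec p)).

Lemma cdom_csec_map p x : cdom (csec_map p) x <-> cdom p (sh_fun f x).
Proof. by []. Qed.

Lemma cval_csec_map p q x : cval p (sh_fun f x) = cval q (sh_fun f x) ->
  cval (csec_map p) x = cval (csec_map q) x.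
Proof. exact: germ_sh_map. Qed.

Lemma cval_csec_map_dom p x : cval (csec_map p) x = cval p (sh_fun f x) :> bool.
Proof. by apply/idP/idP => /cvalP px; apply/cvalP. Qed.

Lemma csec_map_hom : skew_hom csec_map.
Proof.
have zero : csec_map szero = szero.
  by apply: csec_ext => x; rewrite cval_szero cval_out.
split=> // p q; apply: csec_ext => x.
  rewrite cval_smeet /restrict_to cval_csec_map_dom; case: ifPn => [qx|nqx].
    by apply: cval_csec_map; rewrite cval_smeet /restrict_to qx.
  rewrite -(cval_szero x) -zero; apply: cval_csec_map.
  by rewrite cval_szero cval_smeet /restrict_to (negbTE nqx).
rewrite cval_sjoin /override cval_csec_map_dom; case: ifPn => [qx|/negbTE nqx].
  by apply: cval_csec_map; rewrite cval_sjoin /override qx.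
by apply: cval_csec_map; rewrite cval_sjoin /override nqx.
Qed.

(** The image of a compact open downset of [X] is compact, so a compact open
    downset of [Y] covers it. *)
Lemma csec_map_proper : proper_skew_hom csec_map.
Proof.
apply/(proper_skew_homP (@csec_left_handed X) csec_map_hom) => p.
have [_ kp _] := cs_codown p.
have [|V cV pV] := @compact_sub_codown (sh_base Y) (sh_fun f @` cdom p).
  by apply: continuous_compact kp; apply/continuous_subspaceT/lps_hom_continuous.
have [q qV] := csec_over cV; exists q; apply/sle_dom => x px.
by rewrite cdom_csec_map qV; apply: pV; exists x.
Qed.

Definition csec_sdl_hom : sdl_hom (csec_sdl Y) (csec_sdl X) :=
  @SdlHom (csec_sdl Y) (csec_sdl X) csec_map csec_map_hom csec_map_proper.

End CodSectionsMap.

Definition csec_functor : functor ShLPS (opposite SDL).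
Proof.
refine (@Functor ShLPS (opposite SDL) csec_sdl csec_sdl_hom _ _).
  move=> X; apply: sdl_hom_eq => p; apply: csec_ext => x.
  have [px|npx] := pselect (cdom p x); last by rewrite !cval_out.
  by rewrite /cval /= sh_map_id germ_restrict.
move=> X Y Z g f; apply: sdl_hom_eq => p; apply: csec_ext => x.
have [px|npx] := pselect (cdom p (sh_fun g (sh_fun f x))); last by rewrite !cval_out.
by rewrite /cval /= sh_map_comp germ_restrict.
Defined.

(** The domains of the images determine the underlying map, since points are
    separated by compact open downsets that carry sections. The germs of the images
    determine the map of sections, since each germ comes from a section over such
    a set. *)
Lemma csec_functor_faithful (X Y : shlps) (f g : shlps_hom X Y) :
  fmap csec_functor f = fmap csec_functor g -> f = g.
Proof.
move=> fg.
have {}fg p : csec_map f p = csec_map g p.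
  exact: (congr1 (fun h : sdl_hom (csec_sdl Y) (csec_sdl X) => h p) fg).
have fg0 : sh_fun f =1 sh_fun g.
  move=> x; apply: codown_point_inj => U /csec_over [p <-].
  by rewrite -!cdom_csec_map fg.
apply: shlps_hom_eq => // V ba s; apply: (germ_ext (@sh_is_sheaf X)) => x Vgx.
rewrite germ_restrict //.
have Vfx : oset V (sh_fun f x) by rewrite fg0.
have [p ps] := cval_germ s Vfx.
rewrite -(germ_sh_map ps) -[LHS]/(cval (csec_map f p) x) fg.
by apply: germ_sh_map; rewrite -fg0.
Qed.

(** * Fullness *)

Section Full.
Variables (X Y : shlps) (h : sdl_hom (csec_sdl Y) (csec_sdl X)).

Let h_hom : skew_hom h := sdl_fun_hom h.
Let hI (p q : csec Y) : h (p ⊓ q) = h p ⊓ h q := skew_hom_meet h_hom p q.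
Let hU (p q : csec Y) : h (p ⊔ q) = h p ⊔ h q := skew_hom_join h_hom p q.

Lemma cdom_hom_mono (p q : csec Y) : cdom p `<=` cdom q -> cdom (h p) `<=` cdom (h q).
Proof. by move=> /sle_dom pq; apply/sle_dom; rewrite -hI pq. Qed.

(** The domains [cdom p] of those [p] for which [h p] is defined at [x] form a
    prime filter of compact open downsets. It is inhabited because [h] is
    proper. *)
Lemma hom_point x : exists y, forall p : csec Y, cdom (h p) x <-> cdom p y.
Proof.
pose P U := exists2 p : csec Y, cdom p = U & cdom (h p) x.
have PE p : P (cdom p) <-> cdom (h p) x.
  split=> [[q qp qx]|px]; last by exists p.
  by apply: (cdom_hom_mono _ qx); rewrite qp.
have [||U V|U V|y yP] := @codown_prime_point (sh_base Y) P.
- have [U cU Ux] := codown_cover x; have [p pU] := csec_over cU.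
  have /(proper_skew_homP (@csec_left_handed X) h_hom) := sdl_fun_proper h.
  move=> /(_ p) [q /sle_dom pq]; exists (cdom q); first exact: cs_codown.
  by apply/PE/pq; rewrite pU.
- move=> [p p0]; rewrite (_ : p = szero) ?(skew_hom_zero h_hom) //.
  by apply: csec_ext => z; rewrite cval_szero cval_out // p0.
- move=> /csec_over[p <-] /csec_over[q <-].
  by rewrite -[_ `&` _]/(cdom (p ⊓ q)) !PE hI.
- move=> /csec_over[p <-] /csec_over[q <-].
  by rewrite -[_ `|` _]/(cdom (p ⊔ q)) !PE hU.
by exists y => p; rewrite -PE; apply: yP; exact: cs_codown.
Qed.

Definition hom_base (x : sh_base X) : sh_base Y := sval (cid (hom_point x)).

Lemma cdom_hom p x : cdom (h p) x <-> cdom p (hom_base x).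
Proof. by rewrite /hom_base; case: cid. Qed.

Lemma hom_base_ext : exists k, lps_hom_ext hom_base k.
Proof.
apply: lps_hom_of_preimage => V /csec_over[p <-].
rewrite (_ : _ @^-1` _ = cdom (h p)); first exact: cs_codown.
by apply/seteqP; split=> x /cdom_hom.
Qed.

Definition hom_lps : lps_hom (sh_base X) (sh_base Y) := LpsHom hom_base_ext.

(** A homomorphism acts on germs. If [p] and [q] agree near [hom_base x], hence on
    a set [A `\` B], then [(p ⊓ a) ⊔ b = (q ⊓ a) ⊔ b] for sections [a], [b] over
    [A], [B]; apply [h] and look at [x], which lies in the domain of [h a] and
    not in that of [h b]. *)
Lemma cval_hom (p q : csec Y) x :
  cval p (hom_base x) = cval q (hom_base x) -> cval (h p) x = cval (h q) x.
Proof.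
move=> pq; have [px|npx] := pselect (cdom p (hom_base x)); last first.
  by rewrite !cval_out // cdom_hom // -cvalP -pq cvalP.
have [W [Wx _ _ pqW]] := germ_eq_near px pq.
have [|A [B [cA cB Ax nBx AB]]] := @codown_basis _ (hom_base x) (oset W).
  by apply: open_nbhs_nbhs; split=> //; exact: oset_open.
have [a aA] := csec_over cA; have [b bB] := csec_over cB.
have e : (p ⊓ a) ⊔ b = (q ⊓ a) ⊔ b.
  apply: csec_ext => y; rewrite !(cval_sjoin, cval_smeet) /override /restrict_to.
  case: ifPn => // /negP nby; case: ifPn => // ay.
  apply: pqW; apply: AB; split; first by rewrite -aA; apply/cvalP.
  by rewrite -bB => /cvalP.
have := congr1 (fun r => cval (h r) x) e.
rewrite !hU !hI !(cval_sjoin, cval_smeet) /override /restrict_to.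
have -> : cval (h a) x by apply/cvalP/cdom_hom; rewrite aA.
by rewrite (cval_out (p := h b)) // cdom_hom bB.
Qed.

(** For an open [V], the value at [x] of the image of [t] is that of [h p], for any
    [p] with the same germ as [t] at [hom_base x]. By [cval_hom] the choice of [p]
    is immaterial, and one [p] serves near [x], so these values glue. *)
Lemma hom_sections (V : opens (sh_base Y)) (t : sections (sh_presheaf Y) V) :
  exists s : sections (sh_presheaf X) (lps_preimage hom_lps V),
  forall x (p : csec Y), oset V (hom_base x) ->
    cval p (hom_base x) = germ (hom_base x) t -> germ x s = cval (h p) x.
Proof.
pose rep x (Vx : oset V (hom_base x)) := sval (cid (cval_germ t Vx)).
pose g x := if pselect (oset V (hom_base x)) is left Vx then cval (h (rep x Vx)) x
  else None.
have gE x (p : csec Y) : oset V (hom_base x) ->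
    cval p (hom_base x) = germ (hom_base x) t -> g x = cval (h p) x.
  move=> Vx pt; rewrite /g /rep; case: pselect => // Vx'; case: cid => q /= qt.
  by apply: cval_hom; rewrite qt pt.
have [|s sg] := germ_glue (@sh_is_sheaf X) (U := lps_preimage hom_lps V) (g := g).
  move=> x Vx; have [p pt] := cval_germ t Vx.
  have px : cdom p (hom_base x) by exact: germ_dom (esym pt) Vx.
  have [W [Wx Wp WV Wpt]] := germ_eq_near px pt.
  exists (opens_setI (lps_preimage hom_lps W) (cs_open (h p))).
  exists (restrict (@opens_subIr _ _ _) (cs_sec (h p))); split.
    by split=> //; apply/cdom_hom.
  move=> y [Wy py] Vy; rewrite germ_restrict //.
  by symmetry; apply: gE => //; exact: Wpt.
by exists s => x p Vx pt; rewrite sg //; exact: gE.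
Qed.

Definition hom_sec (V : opens (sh_base Y)) (t : sections (sh_presheaf Y) V) :
  sections (sh_presheaf X) (lps_preimage hom_lps V) := sval (cid (hom_sections t)).

Lemma germ_hom_sec (V : opens (sh_base Y)) (t : sections (sh_presheaf Y) V) x p :
  oset V (hom_base x) -> cval p (hom_base x) = germ (hom_base x) t ->
  germ x (hom_sec t) = cval (h p) x.
Proof. by rewrite /hom_sec; case: cid => s /= sP; exact: sP. Qed.

Lemma hom_sec_natural (U V : opens (sh_base Y)) (UV : U `<=` V)
    (UV' : lps_preimage hom_lps U `<=` lps_preimage hom_lps V)
    (t : sections (sh_presheaf Y) V) :
  restrict UV' (hom_sec t) = hom_sec (restrict UV t).
Proof.
apply: (germ_ext (@sh_is_sheaf X)) => x Ux.
have Vx : oset V (hom_base x) by exact: UV.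
have [p pt] := cval_germ t Vx; rewrite germ_restrict // (germ_hom_sec Vx pt).
by symmetry; apply: germ_hom_sec => //; rewrite germ_restrict.
Qed.

Definition hom_shlps : shlps_hom X Y :=
  mk_shlps_hom (X := X) (Y := Y) hom_sec_natural.

Lemma csec_functor_full : exists f : shlps_hom X Y, fmap csec_functor f = h.
Proof.
exists hom_shlps; apply: sdl_hom_eq => p; apply: csec_ext => x.
have [px|npx] := pselect (cdom p (hom_base x)).
  exact: germ_hom_sec.
by rewrite !cval_out // cdom_hom.
Qed.

End Full.

(** * The spectrum of a skew lattice *)

Record spec (S : sdl) := Spec {
  spec_set :> S -> Prop;
  spec_prime : prime_filter (spec_set : set S) }.

Section Spectrum.
Variable S : sdl.
Let SD := sdl_distributive S.
Let LH := @sdl_left_handed S.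
Implicit Types (P Q : spec S) (a b c d : S).

HB.instance Definition _ := gen_eqMixin (spec S).
HB.instance Definition _ := gen_choiceMixin (spec S).

Lemma spec_eq P Q : (forall a, P a <-> Q a) -> P = Q.
Proof.
case: P Q => [P pP] [Q pQ] /= PQ; have {}PQ : P = Q by apply/seteqP; split=> a /PQ.
by subst Q; congr Spec; exact: Prop_irrelevance.
Qed.

(** Reverse inclusion makes the sets [basic a] downsets, and the point at infinity,
    which stands for the empty filter, the maximum. *)
Definition spec_le P Q := `[< spec_set Q `<=` spec_set P >].

Let spec_le_refl : reflexive spec_le. Proof. by move=> P; apply/asboolP. Qed.

Let spec_le_anti : antisymmetric spec_le.
Proof.
move=> P Q /andP[/asboolP QP /asboolP PQ]; apply: spec_eq => a.
by split; [exact: PQ|exact: QP].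
Qed.

Let spec_le_trans : transitive spec_le.
Proof.
move=> Q P R /asboolP QP /asboolP RQ; apply/asboolP; exact: subset_trans QP.
Qed.

HB.instance Definition _ := Order.Le_isPOrder.Build lps_display (spec S)
  spec_le_refl spec_le_anti spec_le_trans.

Definition basic a : set (spec S) := [set P | P a].

Lemma basic_meet a b : basic (a ⊓ b) = basic a `&` basic b.
Proof. by apply/seteqP; split=> P; rewrite /basic /= (pf_meet (spec_prime P)). Qed.

Lemma basic_join a b : basic (a ⊔ b) = basic a `|` basic b.
Proof. by apply/seteqP; split=> P; rewrite /basic /= (pf_join (spec_prime P)). Qed.

Lemma basic_zero : basic szero = set0.
Proof. by apply/seteqP; split=> P //; move=> /(pf_zero (spec_prime P)). Qed.

(** The differences [basic c `\` basic d] are closed under finite intersections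
    because [S] has meets and joins, so they form a base. *)
Definition spec_nbhs P : set_system (spec S) :=
  [set O | exists c d, [/\ P c, ~ P d & basic c `\` basic d `<=` O]].

HB.instance Definition _ := hasNbhs.Build (spec S) spec_nbhs.

Let spec_filter P : ProperFilter (spec_nbhs P).
Proof.
apply: Build_ProperFilter_ex.
  by move=> O [c [d [Pc nPd cdO]]]; exists P; exact: cdO.
split.
- have [c Pc] := pf_inhabited (spec_prime P).
  by exists c, szero; split => //; exact: pf_zero (spec_prime P).
- move=> O O' [c [d [Pc nPd cdO]]] [c' [d' [Pc' nPd' cdO']]].
  exists (c ⊓ c'), (d ⊔ d'); split.
  + by apply/(pf_meet (spec_prime P)).
  + by move=> /(pf_join (spec_prime P))[].
  + move=> Q []; rewrite basic_meet basic_join => -[Qc Qc'] /not_orP[nQd nQd'].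
    by split; [exact: cdO|exact: cdO'].
- move=> O O' OO' [c [d [Pc nPd cdO]]]; exists c, d; split=> //.
  exact: subset_trans OO'.
Qed.

Let spec_nbhs_singleton P (O : set (spec S)) : spec_nbhs P O -> O P.
Proof. by move=> [c [d [Pc nPd]]]; apply. Qed.

Let spec_nbhs_nbhs P (O : set (spec S)) :
  spec_nbhs P O -> spec_nbhs P (spec_nbhs^~ O).
Proof.
move=> [c [d [Pc nPd cdO]]]; exists c, d; split=> // Q [Qc nQd].
by exists c, d.
Qed.

HB.instance Definition _ := Nbhs_isNbhsTopological.Build (spec S)
  spec_filter spec_nbhs_singleton spec_nbhs_nbhs.

Lemma nbhs_basic P a : P a -> nbhs P (basic a).
Proof.
move=> Pa; exists a, szero; split=> //; exact: pf_zero (spec_prime P).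
Qed.

Lemma nbhs_basicC P a : ~ P a -> nbhs P (~` basic a).
Proof.
move=> nPa; have [c Pc] := pf_inhabited (spec_prime P).
by exists c, a; split=> // Q [].
Qed.

Lemma open_basic a : open (basic a).
Proof. by rewrite openE => P; exact: nbhs_basic. Qed.

Lemma closed_basic a : closed (basic a).
Proof. by rewrite -openC openE => P; exact: nbhs_basicC. Qed.

(** An ultrafilter containing [basic a] converges to the prime filter of those [b]
    for which it contains [basic b]. *)
Lemma compact_basic a : compact (basic a).
Proof.
rewrite compact_ultra => F UF Fa.
have PF : ProperFilter F by exact: ultra_proper.
have prime : prime_filter [set b | F (basic b)].
  split.
  - by exists a.
  - by rewrite /= basic_zero; exact: filter_not_empty.
  - move=> b c /=; rewrite basic_meet; split=> [Fbc|[Fb Fc]]; last exact: filterI.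
    by split; apply: filterS Fbc => P [].
  - move=> b c /=; rewrite basic_join; split=> [Fbc|[Fb|Fc]].
    + have [Fb|Fb] := in_ultra_setVsetC (basic b) UF; first by left.
      by right; apply: filterS (filterI Fbc Fb) => P [[//|] ].
    + by apply: filterS Fb => P; left.
    + by apply: filterS Fc => P; right.
exists (Spec prime); split=> // O [c [d [Fc nFd cdO]]].
have [//|Fd] := in_ultra_setVsetC (basic d) UF.
by apply: filterS (filterI Fc Fd) => P; exact: cdO.
Qed.

Lemma downset_basic a : downset (basic a).
Proof. by move=> P Q /asboolP QP; exact: QP. Qed.

Lemma codown_basic a : codown (basic a).
Proof.
by split; [exact: open_basic|exact: compact_basic|exact: downset_basic].
Qed.

Lemma spec_priestley : priestley (ordered_opc (spec S)).
Proof.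
split; first exact: one_point_compactification_compact.
have sep a (x y : ordered_opc (spec S)) : (Some @` basic a) y ->
    ~ (Some @` basic a) x -> exists U V : set (ordered_opc (spec S)),
    [/\ clopen U /\ clopen V, upset U, downset V, U `&` V = set0 & U x /\ V y].
  move=> ya nxa; set V : set (ordered_opc (spec S)) := Some @` basic a in ya nxa *.
  have oV : open V.
    by apply: one_point_compactification_open_some; exact: open_basic.
  have oVC : open (~` V).
    rewrite openE => -[P|] nVP.
      suff : nbhs P (Some @^-1` (~` V)) by [].
      apply: filterS (nbhs_basicC (a := a) _) => [Q nQa [Q' Qa [QQ']]|Pa].
        by apply: nQa; rewrite -QQ'.
      by apply: nVP; exists P.
    exists (basic a).
      by split; [exact: compact_basic|exact: closed_basic].
    move=> _ [[P nPa <-]|->] [Q Qa] // [QP].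
    by apply: nPa; rewrite -QP.
  have clV : closed V by rewrite -openC.
  have dV : downset V.
    move=> [P|] [Q|] // PQ [R Ra] // [RQ]; exists P => //.
    by apply: (@downset_basic a P Q PQ); rewrite -RQ.
  exists (~` V), V; split=> //.
  - by split; split=> //; exact: open_closedC.
  - by move=> z t zt nVz Vt; apply/nVz/dV/Vt.
  - exact: setICl.
move=> [P|] [Q|] //= PQ.
  have /existsNP [a /not_implyP [Qa nPa]] : ~ (spec_set Q `<=` spec_set P).
    by move=> QP; move/negP: PQ; apply; exact/asboolP.
  by apply: (sep a); [exists Q|move=> [R Ra [RP]]; apply: nPa; rewrite -RP].
have [a Qa] := pf_inhabited (spec_prime Q).
by apply: (sep a); [exists Q|move=> []].
Qed.

Definition spec_lps : lps := @Lps (spec S) spec_priestley.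

(** For each [Q] outside the downset [U], some [a] in [P] is not in [Q]. By
    compactness finitely many such [a], and some [c0] to start from, have a meet
    [c] with [basic c `<=` U]. *)
Lemma codown_sub_basic (U : set spec_lps) (P : spec_lps) : codown U -> U P ->
  exists2 c, spec_set P c & basic c `<=` U.
Proof.
move=> cU UP; have [oU kU dU] := cU.
have [c0 Pc0] := pf_inhabited (spec_prime P).
pose Phi W := exists2 c, spec_set P c & W `&` basic c = set0.
have [c Pc cU0] : Phi (basic c0 `\` U).
  apply: compact_induction.
  - apply: (@subclosed_compact _ _ (basic c0)).
    + by rewrite setDE; apply: closedI; [exact: closed_basic|exact: open_closedC].
    + exact: compact_basic.
    + exact: subDsetl.
  - by exists c0 => //; rewrite set0I.
  - move=> A B [c Pc Ac] [c' Pc' Bc']; exists (c ⊓ c').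
      exact/(pf_meet (spec_prime P)).
    rewrite basic_meet; apply/seteqP; split=> // Q [[AQ|BQ] [Qc Qc']].
      by have : (A `&` basic c) Q by []; rewrite Ac.
    by have : (B `&` basic c') Q by []; rewrite Bc'.
  - move=> A B AB [c Pc Bc]; exists c => //; apply/seteqP; split=> // Q [/AB BQ Qc].
    by have : (B `&` basic c) Q by []; rewrite Bc.
  - move=> Q [_ nUQ].
    have /existsNP [a /not_implyP [Pa nQa]] : ~ (spec_set P `<=` spec_set Q).
      by move=> PQ; apply/nUQ/(dU Q P)/UP/asboolP.
    exists (~` basic a); first exact: nbhs_basicC.
    by exists a => //; rewrite setICl.
exists (c ⊓ c0); first exact/(pf_meet (spec_prime P)).
rewrite basic_meet => Q [Qc Qc0]; apply: contrapT => nUQ.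
by have : ((basic c0 `\` U) `&` basic c) Q by []; rewrite cU0.
Qed.

Lemma codown_spec (U : set spec_lps) : codown U -> exists a, U = basic a.
Proof.
move=> cU; have [oU kU dU] := cU.
have [a aU Ua] : exists2 a, basic a `<=` U & U `<=` basic a.
  apply: (@compact_induction _ U (fun W => exists2 a, basic a `<=` U & W `<=` basic a)) => //.
  - by exists szero => //; rewrite basic_zero.
  - move=> A B [a aU Aa] [b bU Bb]; exists (a ⊔ b); rewrite basic_join.
      by move=> P [/aU|/bU].
    exact: setUSS.
  - by move=> A B AB [a aU Ba]; exists a => //; exact: subset_trans Ba.
  - move=> P UP; have [c Pc cU'] := codown_sub_basic cU UP.
    by exists (basic c); [exact: nbhs_basic|exists c].
by exists a; apply/seteqP.
Qed.

(** [a] and [b] are defined at [P] and agree, as partial functions, on the basic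
    neighbourhood [basic c `\` basic d] of [P]. *)
Definition germ_agree P a b :=
  [/\ P a, P b & exists c d, [/\ P c, ~ P d & (a ⊓ c) ⊔ d = (b ⊓ c) ⊔ d]].

Lemma germ_agree_refl P a : P a -> germ_agree P a a.
Proof.
move=> Pa; split=> //; exists a, szero; split=> //; exact: pf_zero (spec_prime P).
Qed.

Lemma germ_agree_sym P a b : germ_agree P a b -> germ_agree P b a.
Proof. by move=> [Pa Pb [c [d [Pc nPd e]]]]; split=> //; exists c, d. Qed.

Lemma germ_agree_trans P b a c : germ_agree P a b -> germ_agree P b c ->
  germ_agree P a c.
Proof.
move=> [Pa Pb [u [v [Pu nPv e]]]] [_ Pc [u' [v' [Pu' nPv' e']]]]; split=> //.
exists (u ⊓ u'), (v ⊔ v'); split.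
- exact/(pf_meet (spec_prime P)).
- by move=> /(pf_join (spec_prime P))[].
(* Agreement persists on the smaller neighbourhood given by [u ⊓ u'] and
   [v ⊔ v']. *)
have shrink w z x y : (x ⊓ w) ⊔ z = (y ⊓ w) ⊔ z -> z ≼ v ⊔ v' -> u ⊓ u' ≼ w ->
    x ⊓ (u ⊓ u') ⊔ (v ⊔ v') = y ⊓ (u ⊓ u') ⊔ (v ⊔ v').
  move=> xy zv uw; have low t : t ⊓ w ⊓ (u ⊓ u') = t ⊓ (u ⊓ u').
    rewrite -smeetA; apply: (smeet_congr SD LH).
      exact: sle_meetr.
    by rewrite smeetA uw smeetxx.
  rewrite -(low x) -(low y); apply: (skew_agree_meet SD LH).
  exact: skew_agree_mono xy.
apply: (etrans (shrink _ _ _ _ e _ _)).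
- exact: sle_joinl.
- exact: sle_meetl.
apply: shrink e' _ _.
- exact: sle_joinr.
- exact: sle_meetr.
Qed.

Definition germ_class P a : set S := [set b | germ_agree P a b].

Lemma germ_classP P a b : P a -> germ_class P a = germ_class P b <-> germ_agree P a b.
Proof.
move=> Pa; split=> [e|ab].
  apply: germ_agree_sym; rewrite -[germ_agree _ _ _]/(germ_class P b a) -e.
  exact: germ_agree_refl.
apply/seteqP; split=> c; rewrite /germ_class /= => h.
  by apply: germ_agree_trans h; exact: germ_agree_sym.
exact: germ_agree_trans ab h.
Qed.

(** The sheaf consists of the functions that send a point to a germ class and are
    locally given by one element of [S]. Requiring the value [set0] off [U] makes
    sections over [U] equal as soon as they agree on [U]. *)
Record spec_section (U : set (spec S)) := SpecSection {
  ss_fun : spec S -> set S;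
  ss_out : forall P, ~ U P -> ss_fun P = set0;
  ss_local : forall P, U P ->
    exists a, nbhs P [set Q : spec S | Q a /\ ss_fun Q = germ_class Q a] }.

Lemma spec_section_eq (U : set (spec S)) (s t : spec_section U) :
  (forall P, U P -> ss_fun s P = ss_fun t P) -> s = t.
Proof.
move=> st; have {}st : ss_fun s = ss_fun t.
  by apply: funext => P; have [/st//|nUP] := pselect (U P); rewrite !ss_out.
case: s t st => [s so sl] [t to tl] /= st; subst t.
by congr SpecSection; exact: Prop_irrelevance.
Qed.

Definition restrict_fun (U : set (spec S)) (s : spec S -> set S) P : set S :=
  if pselect (U P) then s P else set0.

Lemma restrict_funE (U : set (spec S)) s P : U P -> restrict_fun U s P = s P.
Proof. by rewrite /restrict_fun; case: pselect. Qed.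

Lemma restrict_fun_local (U : set (spec S)) s P a : open U -> U P ->
  nbhs P [set Q : spec S | Q a /\ s Q = germ_class Q a] ->
  nbhs P [set Q : spec S | Q a /\ restrict_fun U s Q = germ_class Q a].
Proof.
move=> oU UP; apply: filterS2 (open_nbhs_nbhs (conj oU UP)) => Q UQ /= [Qa <-].
by rewrite restrict_funE.
Qed.

Lemma spec_restrict_subproof (U V : opens spec_lps) (s : spec_section (oset V)) :
  U `<=` V -> (forall P, ~ oset U P -> restrict_fun U (ss_fun s) P = set0) /\
  (forall P, oset U P -> exists a,
    nbhs P [set Q : spec S | Q a /\ restrict_fun U (ss_fun s) Q = germ_class Q a]).
Proof.
move=> UV; split=> [P nUP|P UP]; first by rewrite /restrict_fun; case: pselect.
have [a Na] := ss_local s (UV _ UP); exists a.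
by apply: restrict_fun_local => //; exact: oset_open.
Qed.

Definition spec_restrict (U V : opens spec_lps) (UV : U `<=` V)
    (s : spec_section (oset V)) : spec_section (oset U) :=
  SpecSection (spec_restrict_subproof s UV).1 (spec_restrict_subproof s UV).2.

Definition spec_presheaf : presheaf spec_lps.
Proof.
refine (@Functor (opposite (Opens_cat spec_lps)) SET
  (fun U => spec_section (oset U)) (fun V U (UV : U `<=` V) => spec_restrict UV) _ _).
- move=> U; apply: funext => s; apply: spec_section_eq => P UP.
  exact: restrict_funE.
- move=> U V W VW UV; apply: funext => s; apply: spec_section_eq => P WP.
  by rewrite /= !restrict_funE //; exact: VW.
Defined.

Lemma spec_restrictE (U V : opens spec_lps) (UV : U `<=` V)
    (s : sections spec_presheaf V) (P : spec_lps) : oset U P ->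
  ss_fun (restrict UV s : spec_section (oset U)) P = ss_fun (s : spec_section (oset V)) P.
Proof. exact: restrict_funE. Qed.

Lemma spec_is_sheaf : is_sheaf spec_presheaf.
Proof.
move=> I U V UV cov s compat.
have same i j P : oset (U i) P -> oset (U j) P -> ss_fun (s i) P = ss_fun (s j) P.
  move=> UiP UjP; have := congr1 (fun r : spec_section _ => ss_fun r P) (compat i j).
  by rewrite !spec_restrictE.
pose g P := [set b | exists2 i, oset (U i) P & ss_fun (s i) P b].
have gE i P : oset (U i) P -> g P = ss_fun (s i) P.
  move=> UiP; apply/seteqP; split=> [b [j UjP]|b sb]; last by exists i.
  by rewrite (same j i).
have g_out P : ~ oset V P -> g P = set0.
  by move=> nVP; apply/seteqP; split=> // b [i /UV].
have g_local P : oset V P -> exists a, nbhs P [set Q : spec S | Q a /\ g Q = germ_class Q a].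
  move=> /cov [i _ UiP]; have [a Na] := ss_local (s i) UiP; exists a.
  apply: filterS2 (open_nbhs_nbhs (conj (oset_open (U i)) UiP)) Na => Q UiQ /= [Qa <-].
  by split=> //; exact: gE.
exists (SpecSection g_out g_local); split=> [i|t tP].
  apply: spec_section_eq => P UiP.
  by rewrite [LHS]spec_restrictE //=; exact: gE.
apply: spec_section_eq => P /cov [i _ UiP] /=.
by rewrite (gE i) // -(tP i) spec_restrictE.
Qed.

Definition spec_open a : opens spec_lps := @Opens spec_lps (basic a) (@open_basic a).

Lemma germ_class_out a P : ~ basic a P -> germ_class P a = set0.
Proof. by move=> nPa; apply/seteqP; split=> // b []. Qed.

Lemma germ_class_local a P : basic a P ->
  exists b, nbhs P [set Q : spec S | Q b /\ germ_class Q a = germ_class Q b].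
Proof. by move=> Pa; exists a; apply: filterS (nbhs_basic Pa) => Q. Qed.

Definition spec_const a : sections spec_presheaf (spec_open a) :=
  SpecSection (@germ_class_out a) (@germ_class_local a).

Lemma spec_global_support : global_support spec_presheaf.
Proof.
move=> P; have [a Pa] := pf_inhabited (spec_prime P).
have Pa' : oset (spec_open a) P by [].
by exists; exact: \pi_{eq_quot (germ_equiv spec_presheaf P)} (LocalSection Pa' (spec_const a)).
Qed.

Definition spec_shlps : shlps := ShLps spec_is_sheaf spec_global_support.

(** The element [a] viewed as the partial function that sends [P] in [basic a] to
    the germ of [a] at [P]; it is the isomorphism from [S] to the skew lattice of
    sections of its sheaf. *)
Definition spec_unit a : csec spec_shlps :=
  @CSec spec_shlps (spec_open a) (codown_basic a) (spec_const a).

Lemma cval_unit_dom a P : cval (spec_unit a) P <-> P a.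
Proof. exact: cvalP. Qed.

Lemma cval_unit a b P : P a ->
  cval (spec_unit a) P = cval (spec_unit b) P <-> germ_agree P a b.
Proof.
move=> Pa; split=> [/(germ_eqP (spec_const a) (spec_const b) (Pa : oset (spec_open a) P))|].
  move=> [W [Wa [Wb [WP e]]]]; apply/germ_classP => //.
  have := congr1 (fun r : spec_section _ => ss_fun r P) e.
  by rewrite !spec_restrictE.
move=> [_ Pb [c [d [Pc nPd e]]]].
have oW : open ((basic c `\` basic d) `&` (basic a `&` basic b)).
  rewrite setDE; apply: openI; apply: openI; try exact: open_basic.
  by rewrite openC; exact: closed_basic.
pose W : opens spec_lps := Opens oW.
have Wa : W `<=` spec_open a by move=> Q [_ []].
have Wb : W `<=` spec_open b by move=> Q [_ []].
apply/(germ_eqP (spec_const a) (spec_const b) (Pa : oset (spec_open a) P)).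
exists W, Wa, Wb; split=> //; apply: spec_section_eq => Q WQ.
rewrite !spec_restrictE //=; case: WQ => -[Qc nQd] [Qa Qb].
by apply/germ_classP => //; split=> //; exists c, d.
Qed.

Lemma cval_unit_local (p : csec spec_shlps) (P : spec_lps) : cdom p P ->
  exists a, nbhs P [set Q : spec_lps | Q a /\ cval p Q = cval (spec_unit a) Q].
Proof.
move=> pP; have [a Na] := ss_local (cs_sec p : spec_section _) pP; exists a.
have Np := open_nbhs_nbhs (conj (oset_open (cs_open p)) pP).
have N := filterI Np Na.
set A := _ `&` _ in N.
pose O : set spec_lps := A°.
have oO : open O by exact: open_interior.
have ON : O `<=` A by exact: interior_subset.
have OP : O P by exact: N.
apply: filterS (open_nbhs_nbhs (conj oO OP)) => Q OQ; have [pQ [Qa _]] := ON Q OQ; split=> //.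
apply/(germ_eqP (cs_sec p) (spec_const a) pQ).
have Op : Opens oO `<=` cs_open p by move=> R /ON [].
have Oa : Opens oO `<=` spec_open a by move=> R /ON [_ []].
exists (Opens oO), Op, Oa; split=> //; apply: spec_section_eq => R OR.
by rewrite !spec_restrictE //=; have [_ []] := ON R OR.
Qed.

Lemma cval_unit_meet a b P : cval (spec_unit (a ⊓ b)) P =
  restrict_to (cval (spec_unit a) P) (cval (spec_unit b) P).
Proof.
rewrite /restrict_to; have [Pb|nPb] := pselect (P b); last first.
  rewrite (cval_out (p := spec_unit b)) // cval_out //.
  by move=> /(pf_meet (spec_prime P))[].
have -> : cval (spec_unit b) P by exact/cval_unit_dom.
have [Pa|nPa] := pselect (P a); last first.
  by rewrite !cval_out // => /(pf_meet (spec_prime P))[].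
have Pab : P (a ⊓ b) by exact/(pf_meet (spec_prime P)).
apply/cval_unit => //; split=> //; exists b, szero; split=> //.
  exact: pf_zero (spec_prime P).
by rewrite -smeetA smeetxx.
Qed.

Lemma cval_unit_join a b P : cval (spec_unit (a ⊔ b)) P =
  override (cval (spec_unit a) P) (cval (spec_unit b) P).
Proof.
rewrite /override; have [Pb|nPb] := pselect (P b).
  have -> : cval (spec_unit b) P by exact/cval_unit_dom.
  have Pab : P (a ⊔ b) by apply/(pf_join (spec_prime P)); right.
  apply/cval_unit => //; split=> //; exists b, szero; split=> //.
    exact: pf_zero (spec_prime P).
  by rewrite sjoinIK smeetxx.
rewrite (cval_out (p := spec_unit b)) //.
have [Pa|nPa] := pselect (P a); last first.
  by rewrite !cval_out // => /(pf_join (spec_prime P))[].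
have Pab : P (a ⊔ b) by apply/(pf_join (spec_prime P)); left.
apply/cval_unit => //; split=> //; exists a, b; split=> //.
by rewrite (SD.2 a a b) smeetxx -sjoinA (sjoin_equiv (sle_meetl LH b a)).
Qed.

Lemma spec_unit_hom : skew_hom spec_unit.
Proof.
split=> [a b|a b|]; apply: csec_ext => P.
- by rewrite cval_smeet cval_unit_meet.
- by rewrite cval_sjoin cval_unit_join.
- by rewrite cval_szero cval_out // => /(pf_zero (spec_prime P)).
Qed.

Lemma spec_unit_inj : injective spec_unit.
Proof.
move=> a b ab; apply: contrapT => neq.
have [P0 [primeP Pab sep]] := prime_filter_separation SD LH neq.
pose P : spec S := Spec primeP.
have abP : cval (spec_unit a) P = cval (spec_unit b) P by rewrite ab.
have Pa : P a.
  have [//|Pb] := (pf_join primeP a b).1 Pab.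
  by apply/cval_unit_dom; rewrite abP; apply/cval_unit_dom.
have [_ _ [c [d [Pc nPd e]]]] := (cval_unit b Pa).1 abP.
exact: sep Pc nPd e.
Qed.

(** By compactness it suffices to extend agreement with [p] from a set [W1] to
    [W1 `|` W], for a neighbourhood [W] of each point. If [a] agrees with [p] on
    [W1], and [a'] does on [W = basic c `\` basic d], then
    [a ⊔ (a' ⊓ c) ⊔ (a ⊓ d)] agrees with [p] on both: it first overrides [a] by
    [a'] on [basic c], and then restores [a] on [basic d]. *)
Lemma spec_unit_surj (p : csec spec_shlps) : exists a, spec_unit a = p.
Proof.
have [u pu] := codown_spec (cs_codown p).
pose good (W : set spec_lps) a := forall Q : spec_lps, W Q ->
  cdom p Q /\ cval (spec_unit a) Q = cval p Q.
pose Phi W := forall W1 a, good W1 a -> exists b, good (W1 `|` W) b.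
have [a aP] : exists a, good (cdom p) a.
  suff /(_ set0 szero) [//|a] : Phi (cdom p) by rewrite set0U; exists a.
  apply: compact_induction.
  - by case: (cs_codown p).
  - by move=> W1 a; rewrite setU0; exists a.
  - move=> A B PA PB W1 a /PA [b /PB [c]]; rewrite -setUA; by exists c.
  - move=> A B AB PB W1 a /PB [b bP]; exists b => Q [W1Q|AQ]; apply: bP.
      by left.
    by right; exact: AB.
  - move=> P pP; have [a' [c [d [Pc nPd cdN]]]] := cval_unit_local pP.
    pose W := (basic c `\` basic d) `&` cdom p.
    exists W.
      have oW : nbhs P (basic c `\` basic d).
        by rewrite setDE; apply: filterI; [exact: nbhs_basic|exact: nbhs_basicC].
      exact: filterI oW (open_nbhs_nbhs (conj (oset_open (cs_open p)) pP)).
    move=> W1 a aP; exists (a ⊔ (a' ⊓ c) ⊔ (a ⊓ d)) => Q W1WQ.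
    have pQ : cdom p Q by case: W1WQ => [/aP[]|[]].
    split=> //; rewrite !(cval_unit_join, cval_unit_meet) /override /restrict_to.
    have [Qcd|nQcd] := pselect ((basic c `\` basic d) Q).
      have [Qa' ->] := cdN Q Qcd; case: Qcd => Qc nQd.
      rewrite (cval_out (p := spec_unit d)) //=.
      have -> : cval (spec_unit c) Q by exact/cval_unit_dom.
      by have -> : cval (spec_unit a') Q by exact/cval_unit_dom.
    have [_ vQ] : cdom p Q /\ cval (spec_unit a) Q = cval p Q.
      by case: W1WQ => [/aP//|[]].
    rewrite vQ; have vpQ := cval_in pQ.
    have [Qd|nQd] := pselect (Q d).
      have -> : cval (spec_unit d) Q by exact/cval_unit_dom.
      by rewrite vpQ.
    have nQc : ~ Q c by move=> Qc; exact: nQcd.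
    by rewrite (cval_out (p := spec_unit d)) // (cval_out (p := spec_unit c)).
(* Outside the domain of [p] the element [a] is uncontrolled; [u] cuts it down. *)
exists (a ⊓ u); apply: csec_ext => Q; rewrite cval_unit_meet /restrict_to.
case: ifPn => [/cval_unit_dom Qu|/negP nu].
  by apply: (aP Q _).2; rewrite /cdom pu.
rewrite cval_out // => pQ; apply: nu; apply/cval_unit_dom.
by move: pQ; rewrite /cdom pu.
Qed.

End Spectrum.

(** * The duality *)

Lemma sdl_bijective_iso (S T : sdl) (h : S -> T) : skew_hom h -> injective h ->
  (forall b, exists a, h a = b) ->
  exists e : hom (T : opposite SDL) (S : opposite SDL), is_iso e.
Proof.
move=> hh h_inj h_surj; pose g b := sval (cid (h_surj b)).
have hK b : h (g b) = b by rewrite /g; case: cid.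
have gK a : g (h a) = a by apply: h_inj; rewrite hK.
have gh : skew_hom g.
  split=> [b b'|b b'|]; apply: h_inj.
  - by rewrite (skew_hom_meet hh) !hK.
  - by rewrite (skew_hom_join hh) !hK.
  - by rewrite (skew_hom_zero hh) hK.
have hp : proper_skew_hom h.
  apply/(proper_skew_homP (@sdl_left_handed T) hh) => b.
  by exists (g b); rewrite hK smeetxx.
have gp : proper_skew_hom g.
  apply/(proper_skew_homP (@sdl_left_handed S) gh) => a.
  by exists (h a); rewrite gK smeetxx.
exists (SdlHom hh hp), (SdlHom gh gp).
by split; apply: sdl_hom_eq => x /=; rewrite ?hK ?gK.
Qed.

Theorem theorem3p7 : equivalent_categories (opposite SDL) ShLPS.
Proof.
apply: (@fully_faithful_equivalence _ _ csec_functor).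
- by move=> X Y h; exact: csec_functor_full.
- by move=> X Y f g; exact: csec_functor_faithful.
- move=> S; exists (spec_shlps S).
  by apply: sdl_bijective_iso; [exact: spec_unit_hom|exact: spec_unit_inj|exact: spec_unit_surj].
Qed.
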